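(* There is a deterministic distributed algorithm that computes a maximal independent set in $O(\log^2\Delta\cdot\log n)$ rounds of the $\mathsf{LOCAL}$ model, and in $O(\log^2\Delta\cdot\log\log\Delta\cdot\log n)$ rounds of the $\mathsf{CONGEST}$ model, in any $n$-node graph with maximum degree at most $\Delta$.
   Context: Distributed message-passing model: the network is an undirected $n$-node graph $G$; each node has a unique $O(\log n)$-bit identifier and initially knows only its identifier (and upper bounds on global parameters such as $n$ and $\Delta$); computation proceeds in synchronous rounds, in each of which every node can send a message to each neighbor. In the $\mathsf{LOCAL}$ model messages have unbounded size; in the $\mathsf{CONGEST}$ model messages have $O(\log n)$ bits. At the end each node must know whether it belongs to the computed set. A maximal independent set is a set of pairwise non-adjacent nodes such that every node not in the set has a neighbor in the set. *)

(* Defs.v *)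
From mathcomp Require Import all_boot.

Set Implicit Arguments.
Unset Strict Implicit.
Unset Printing Implicit Defensive.

(* Binary logarithm, rounded up and at least 1, so that O(log x) bounds keep
   their usual meaning for x = 0, 1, 2 and iterated logarithms do not vanish. *)
Definition log2 (x : nat) : nat := maxn 1 (up_log 2 x).

Record graph := Graph {
  vertex :> finType;
  adj : rel vertex;
  adj_sym : symmetric adj;
  adj_irr : irreflexive adj }.

Definition degree (G : graph) (v : vertex G) : nat := #|[set u | adj v u]|.

Definition is_MIS (G : graph) (M : {set vertex G}) : Prop :=
  (forall u v, u \in M -> v \in M -> ~~ adj u v) /\
  (forall v, v \notin M -> exists2 u, u \in M & adj v u).

(* A node addresses its neighbors only through local ports 0, ..., deg - 1:
   [port v] lists the neighbors of [v] in an arbitrary (adversarial) order, so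
   nothing about the neighbors' identifiers is known initially. *)
Record network := Network {
  topology :> graph;
  port : vertex topology -> seq (vertex topology);
  port_uniq : forall v, uniq (port v);
  mem_port : forall v u, (u \in port v) = adj v u;
  ident : vertex topology -> nat;
  ident_inj : injective ident }.

Definition message := seq bool.

(* Local computation is unrestricted and every node runs the same program.
   [init N D i] is the initial state of the node with identifier [i], given the
   upper bounds [N] on the number of nodes and [D] on the maximum degree;
   [send s p] is the message a node in state [s] sends through port [p];
   [recv s ms] is its next state, where the [p]-th entry of [ms] is the message
   arriving through port [p];
   [output s] is [Some b] once the node has decided (true = in the set). *)
Record algorithm := Algorithm {
  state : Type;
  init : nat -> nat -> nat -> state;
  send : state -> nat -> message;
  recv : state -> seq message -> state;
  output : state -> option bool }.

Section Execution.

Variables (A : algorithm) (G : network) (N D : nat).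

(* States after [t] synchronous rounds. *)
Fixpoint run (t : nat) : vertex G -> state A :=
  if t is t'.+1 then
    fun v => recv (run t' v)
               [seq send (run t' u) (index v (port u)) | u <- port v]
  else fun v => init A N D (ident v).

(* Decisions are irrevocable: every node [v] is undecided before some round
   [t <= T] and knows from then on whether it belongs to [M]. *)
Definition computes_MIS_within (T : nat) : Prop :=
  exists M : {set vertex G}, is_MIS M /\
    forall v, exists2 t, t <= T &
      forall r, output (run r v) = if r < t then None else Some (v \in M).

Definition messages_within (b : nat) : Prop :=
  forall (t : nat) (v : vertex G) (p : nat),
    p < size (port v) -> size (send (run t v) p) <= b.

End Execution.

(* [G] is an [n]-node network of maximum degree at most [D]; its identifiers
   have O(log n) bits and the known upper bound [N] on [n] is polynomial in [n],
   with [c] the hidden constant in both cases. *)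
Definition admissible (c n N D : nat) (G : network) : Prop :=
  [/\ #|vertex G| = n,
      forall v : vertex G, degree v <= D,
      n <= N,
      log2 N <= c * log2 n &
      forall v : vertex G, ident v < 2 ^ (c * log2 n)].

(* Main.v *)
(* Luby's algorithm, derandomized by local rounding.

   In every phase each active node [v] has a level [k v], the rounded logarithm
   of its degree, and starts with the marking probability [2 ^ -(k v + 2)].  A
   marked node joins unless a marked neighbor has at least its level.  By
   Bonferroni's inequality the number of removed edges is at least a linear minus
   a quadratic function of the marks, and at the initial probabilities this bound
   is a constant fraction of all edges.  Nodes below a common neighbor [u] are
   thinned by the factors [2 ^ k v / 2 ^ k u], so that all terms stay balanced.

   The probabilities are made integral in [K + 2 = O(log Delta)] steps; step [i]
   replaces the value [2 ^ i] (in units of the smallest probability) by [0] or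
   [2 ^ i.+1], by conditional expectations along a coloring.  A coloring with
   [O(log Delta)] colors suffices if the monochromatic pairs carry at most a
   [1 / (6 (K + 2))] fraction of the quadratic cost; the loss is paid for by letting
   the weight of the quadratic term decrease from 2 to 1 over the steps.

   Such a coloring is found in two stages from a proper distance-two coloring with
   [poly Delta] colors.  First, colors are read as polynomials over a field with
   [O(log^2 Delta)] elements and every node picks an evaluation point with few
   weighted collisions, fixing one bit of it per round: the expected number of
   collisions given the bits so far is a sum over neighbors of neighbors, which the
   common neighbors relay as one number.  Then the new colors are read as
   quartics over a field with [q = O(log Delta)] elements; in round [t] the
   undecided nodes try the value at [t] and keep it if few neighbors have it.

   Each step takes [O(log Delta)] rounds with [O(log n)]-bit messages, so a single
   algorithm meets both bounds. *)

Require Import Defs.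
From mathcomp Require Import all_boot ssralg poly finalg finfield zify.

Set Implicit Arguments.
Unset Strict Implicit.
Unset Printing Implicit Defensive.

(** * Polynomial codes over fields of size a power of two *)

Section PolynomialCodes.

Import GRing.Theory.
Local Open Scope ring_scope.

(** The word of [c] lists the values of a monic polynomial of degree [d] whose lower coefficients
    form the [c]-th tuple over [F]. Two such polynomials differ by one of degree below [d]. The
    fixed leading term keeps the polynomial nonzero after subtracting any constant, which gives the
    last bound. *)
Lemma monic_poly_code (F : finFieldType) (d : nat) : (0 < d)%N ->
  {code : nat -> nat -> nat |
    [/\ forall c a, (code c a < #|F|)%N,
        forall c c', (c < #|F| ^ d)%N -> (c' < #|F| ^ d)%N -> c != c' ->
          (\sum_(a < #|F|) (code c a == code c' a) <= d)%N &
        forall c y, (\sum_(a < #|F|) (code c a == y) <= d)%N]}.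
Proof.
move=> d0; pose E := enum F; pose T := enum {ffun 'I_d -> F}.
have sE : size E = #|F| by rewrite -cardE.
have inE' x : x \in E by rewrite mem_enum.
have sT : size T = (#|F| ^ d)%N by rewrite -cardE card_ffun card_ord.
pose low c := \poly_(i < d)
  (if insub i is Some j then nth [ffun=> 0] T c j else 0).
pose p c := 'X^d + low c.
pose code c a := index (p c).[nth 0 E a] E.
have roots (g : {poly F}) : (g != 0) ->
    (\sum_(a < #|F|) root g (nth 0%R E a) < size g)%N.
  move=> g0; have -> : (\sum_(a < #|F|) root g (nth 0%R E a))%N
                     = size [seq x <- E | root g x].
    rewrite -sE size_filter -sum1_count (big_nth 0) big_mkord.
    by rewrite [RHS]big_mkcond; apply: eq_bigr => i _; case: root.
  apply: max_poly_roots => //; first by rewrite filter_all.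
  by rewrite filter_uniq // enum_uniq.
have codeE c x a : (x \in E) -> (code c a == index x E) = root (p c - x%:P) (nth 0 E a).
  move=> xE; rewrite rootE hornerD hornerN hornerC subr_eq0.
  apply/eqP/eqP=> [/(congr1 (nth 0 E))|e]; last by rewrite /code e.
  by rewrite !nth_index.
exists code; split=> [c a|c c' lc lc' nc|c y].
- by rewrite -sE index_mem.
- have -> : (\sum_(a < #|F|) (code c a == code c' a) =
             \sum_(a < #|F|) root (p c - p c') (nth 0%R E a))%N.
    apply: eq_bigr => a _; congr nat_of_bool.
    rewrite -[code c' a]/(index (p c').[nth 0 E a] E) codeE //.
    by rewrite !rootE !hornerD !hornerN hornerC !hornerD.
  have -> : p c - p c' = low c - low c' by rewrite /p opprD addrACA subrr add0r.
  apply: (@leq_trans (size (low c - low c'))).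
    apply/ltnW/roots; rewrite subr_eq0; apply: contra nc => /eqP e.
    rewrite -(nth_uniq [ffun=> 0] _ _ (enum_uniq {ffun 'I_d -> F})) -?/T ?sT //.
    apply/eqP/ffunP=> i; move: (congr1 (fun g : {poly F} => g`_i) e).
    by rewrite !coef_poly ltn_ord valK.
  by rewrite (leq_trans (size_polyD _ _)) // geq_max size_polyN !size_poly.
- have [ly|gy] := ltnP y #|F|; last first.
    rewrite big1 // => a _; apply/eqP; rewrite eqb0; apply/eqP=> e.
    by move: gy; rewrite -e leqNgt -[X in (_ < X)%N]sE index_mem inE'.
  have sp : size (p c - (nth 0 E y)%:P) = d.+1.
    rewrite /p -addrA size_polyDl ?size_polyXn // ltnS.
    rewrite (leq_trans (size_polyD _ _)) // geq_max size_poly size_polyN.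
    by rewrite (leq_trans (size_polyC_leq1 _)).
  rewrite -ltnS -sp; apply: leq_ltn_trans (roots _ _).
    apply: eq_leq; apply: eq_bigr => a _; congr nat_of_bool.
    by rewrite -codeE // index_uniq ?sE ?enum_uniq.
  by rewrite -size_poly_eq0 sp.
Qed.

End PolynomialCodes.

(** Positivity is assumed under the existential so that [code] is total in [r] and [d]. *)
Lemma code_exists (r d : nat) :
  {code : nat -> nat -> nat |
    0 < r -> 0 < d ->
    [/\ forall c a, code c a < 2 ^ r,
        forall c c', c < 2 ^ (r * d) -> c' < 2 ^ (r * d) -> c != c' ->
          \sum_(a < 2 ^ r) (code c a == code c' a) <= d &
        forall c y, \sum_(a < 2 ^ r) (code c a == y) <= d]}.
Proof.
case: (posnP r) => [->|r0]; first by exists (fun _ _ => 0).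
case: (posnP d) => [->|d0]; first by exists (fun _ _ => 0).
have [F _ cF] := pPrimePowerField (isT : prime 2) r0.
have [code] := monic_poly_code F d0; rewrite cF => H.
by exists code => _ _; rewrite expnM.
Qed.

Definition code (r d : nat) : nat -> nat -> nat := sval (code_exists r d).

Lemma code_lt r d c a : 0 < r -> 0 < d -> code r d c a < 2 ^ r.
Proof. by move=> r0 d0; have [H _ _] := svalP (code_exists r d) r0 d0; apply: H. Qed.

Lemma code_agree r d c c' : 0 < r -> 0 < d ->
  c < 2 ^ (r * d) -> c' < 2 ^ (r * d) -> c != c' ->
  \sum_(a < 2 ^ r) (code r d c a == code r d c' a) <= d.
Proof. by move=> r0 d0; have [_ H _] := svalP (code_exists r d) r0 d0; apply: H. Qed.

Lemma code_hit r d c y : 0 < r -> 0 < d ->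
  \sum_(a < 2 ^ r) (code r d c a == y) <= d.
Proof. by move=> r0 d0; have [_ _ H] := svalP (code_exists r d) r0 d0; apply: H. Qed.

(** * Aggregation programs and their execution by message passing *)

Fixpoint bits (w x : nat) : seq bool :=
  if w is w'.+1 then odd x :: bits w' x./2 else [::].

Definition num (s : seq bool) : nat := foldr (fun (b : bool) x => b + x.*2) 0 s.

Lemma size_bits w x : size (bits w x) = w.
Proof. by elim: w x => //= w IH x; rewrite IH. Qed.

Lemma bitsK w x : x < 2 ^ w -> num (bits w x) = x.
Proof.
elim: w x => [|w IH] x /=; first by rewrite expn0; case: x.
move=> lx; rewrite IH ?odd_double_half //.
by rewrite -(ltn_pmul2l (isT : 0 < 2)) -expnS (leq_ltn_trans _ lx) // mul2n
           -[leqRHS]odd_double_half leq_addl.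
Qed.

Definition encode (w : nat) (s : seq nat) : message :=
  flatten [seq bits w x | x <- s].

Definition decode (w k : nat) (m : message) : seq nat :=
  [seq num b | b <- reshape (nseq k w) m].

Lemma size_encode w s : size (encode w s) = size s * w.
Proof.
by elim: s => //= x s IH; rewrite size_cat size_bits mulSn -IH.
Qed.

Lemma encodeK w s : all (fun x => x < 2 ^ w) s ->
  decode w (size s) (encode w s) = s.
Proof.
move=> /allP bs; rewrite /decode /encode.
have -> : nseq (size s) w = shape [seq bits w x | x <- s].
  by elim: s {bs} => //= x s ->; rewrite size_bits.
rewrite flattenK -map_comp -[RHS]map_id; apply/eq_in_map => x xs /=.
by rewrite bitsK ?bs.
Qed.

(* [lev] is the level, [updeg] the number of active neighbors at or above it,
   [mass] the marking probability in units of [2 ^ -(K + 2)]; [base] is the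
   distance-two color, [hue] the color after the first recoloring of a step,
   [slot] the final one, and [pre] the low bits of an evaluation point. *)
Record reg := Reg {
  active : bool; joined : bool; lev : nat; updeg : nat; mass : nat;
  base : nat; hue : nat; pre : nat; slot : nat }.

Definition reg_seq (r : reg) : seq nat :=
  [:: active r : nat; joined r : nat; lev r; updeg r; mass r; base r; hue r;
      pre r; slot r].

Definition seq_reg (s : seq nat) : reg :=
  Reg (nth 0 s 0 == 1) (nth 0 s 1 == 1) (nth 0 s 2) (nth 0 s 3) (nth 0 s 4)
      (nth 0 s 5) (nth 0 s 6) (nth 0 s 7) (nth 0 s 8).

Lemma reg_seqK : cancel reg_seq seq_reg.
Proof. by case=> [[] []]. Qed.

(* One instruction costs two rounds: every node first sends its registers to
   its neighbors, and then [u] answers each neighbor [v] with the two sums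
   (indexed by a bit [b]) of [hop2 b v u w] over the other neighbors [w]. *)
Record instr := Instr {
  hop2 : bool -> reg -> reg -> reg -> nat;
  hop1 : bool -> reg -> reg -> nat;
  advance : reg -> nat -> nat -> reg }.

(** [heard] tells the two rounds of an instruction apart: it is [None] in the first and holds the
    registers of the neighbors, in port order, in the second. The remaining [prog] serves as program
    counter. *)
Record node := Node {
  width : nat; prog : seq instr; heard : option (seq reg); own : reg }.

(** Omitting port [p] keeps the asking node out of its own sum. A node at the end of several paths
    of length two is counted once per middle node, as in [wt] below. *)
Definition relay (i : instr) (r : reg) (l : seq reg) (p : nat) (b : bool) : nat :=
  \sum_(0 <= j < size l | j != p) hop2 i b (nth r l p) r (nth r l j).

Definition machine_send (s : node) (p : nat) : message :=
  if prog s is i :: _ then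
    if heard s is Some l then
      encode (width s) [seq relay i (own s) l p b | b <- [:: false; true]]
    else encode (width s) (reg_seq (own s))
  else [::].

Definition machine_recv (s : node) (ms : seq message) : node :=
  if prog s is i :: P then
    if heard s is Some l then
      let total (b : bool) := \sum_(0 <= j < size l)
        (hop1 i b (own s) (nth (own s) l j)
         + nth 0 (decode (width s) 2 (nth [::] ms j)) b) in
      Node (width s) P None (advance i (own s) (total false) (total true))
    else
      Node (width s) (i :: P)
        (Some [seq seq_reg (decode (width s) 9 m) | m <- ms]) (own s)
  else s.

Definition machine (wd : nat -> nat -> nat) (P : nat -> nat -> seq instr)
    (start : nat -> reg) : algorithm :=
  Algorithm (fun N D id => Node (wd N D) (P N D) None (start id))
    machine_send machine_recv
    (fun s => if prog s is [::] then Some (joined (own s)) else None).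

Definition gather (G : graph) (s : {ffun vertex G -> reg}) (i : instr) (b : bool)
    (v : vertex G) : nat :=
  \sum_(u | adj v u) (hop1 i b (s v) (s u)
     + \sum_(w | adj u w && (w != v)) hop2 i b (s v) (s u) (s w)).

Definition step (G : graph) (s : {ffun vertex G -> reg}) (i : instr) :
    {ffun vertex G -> reg} :=
  [ffun v => advance i (s v) (gather s i false v) (gather s i true v)].

Definition exec (G : graph) (s : {ffun vertex G -> reg}) (P : seq instr) :=
  foldl (@step G) s P.

(** * Simulation of aggregation programs by synchronous rounds *)

Fixpoint every (T : Type) (p : T -> Prop) (s : seq T) : Prop :=
  if s is x :: s' then p x /\ every p s' else True.

Lemma every_cat (T : Type) (p : T -> Prop) s1 s2 :
  every p s1 -> every p s2 -> every p (s1 ++ s2).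
Proof. by elim: s1 => //= x s1 IH [px p1] p2; split=> //; apply: IH. Qed.

Section Correctness.

Variables (wd : nat -> nat -> nat) (P : nat -> nat -> seq instr).
Variables (start : nat -> reg) (G : network) (N D : nat).
Variables (K Y : nat) (bounded : reg -> Prop).

Let A := machine wd P start.
Let w := wd N D.
Let s0 : {ffun vertex G -> reg} := [ffun v => start (ident v)].

(** What makes messages decodable: registers stay within their ranges, and each relayed term is at
    most [Y], so a sum over at most [2 ^ K] neighbors fits in [w] bits. *)
Definition tame (i : instr) : Prop :=
  (forall r x y, bounded r -> bounded (advance i r x y)) /\
  (forall b r r' r'', bounded r -> bounded r' -> bounded r'' ->
     hop2 i b r r' r'' <= Y).

Hypothesis deg_le : forall v : vertex G, degree v <= 2 ^ K.
Hypothesis relay_fit : 2 ^ K * Y < 2 ^ w.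
Hypothesis bounded_fit : forall r, bounded r -> all (fun x => x < 2 ^ w) (reg_seq r).
Hypothesis bounded_start : forall v : vertex G, bounded (start (ident v)).
Hypothesis tame_prog : every tame (P N D).

Lemma port_sum (u : vertex G) (p : pred (vertex G)) (f : vertex G -> nat) :
  \sum_(x <- port u | p x) f x = \sum_(x | adj u x && p x) f x.
Proof.
rewrite -big_filter -[RHS]big_filter; apply: perm_big; apply: uniq_perm.
- by rewrite filter_uniq ?port_uniq.
- by rewrite filter_uniq ?index_enum_uniq.
by move=> x; rewrite !mem_filter mem_index_enum mem_port andbT andbC.
Qed.

Lemma relayE (s : {ffun vertex G -> reg}) i (u v : vertex G) b : adj u v ->
  relay i (s u) [seq s x | x <- port u] (index v (port u)) b
  = \sum_(x | adj u x && (x != v)) hop2 i b (s v) (s u) (s x).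
Proof.
move=> uv; rewrite /relay size_map -port_sum (big_nth v) -/(size _).
have pv : v \in port u by rewrite mem_port.
rewrite big_nat_cond [RHS]big_nat_cond; apply: eq_big => [j|j /andP[/andP[_ lj] _]].
  have [lj|] := boolP (j < size (port u)); last by rewrite andbF.
  congr (_ && ~~ _); rewrite -{3}[v](nth_index v pv).
  by rewrite nth_uniq ?port_uniq ?index_mem.
by rewrite !(nth_map v) ?index_mem // nth_index.
Qed.

Lemma step_bounded (s : {ffun vertex G -> reg}) i :
  tame i -> (forall v, bounded (s v)) -> forall v, bounded (step s i v).
Proof. by move=> [ti _] bs v; rewrite ffunE; apply: ti. Qed.

(** Both messages survive encoding, the registers by [bounded_fit] and the relayed sums by
    [relay_fit], so two rounds realize exactly one [step]. *)
Lemma round_pair (s : {ffun vertex G -> reg}) i Q t :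
  tame i -> (forall v, bounded (s v)) ->
  (forall v, run A N D t v = Node w (i :: Q) None (s v)) ->
  (forall v : vertex G, prog (run A N D t.+1 v) = i :: Q) /\
  (forall v, run A N D t.+2 v = Node w Q None (step s i v)).
Proof.
move=> [_ ti] bs rt.
have half v : run A N D t.+1 v = Node w (i :: Q) (Some [seq s x | x <- port v]) (s v).
  rewrite /= !rt /=; congr (Node _ _ (Some _) _).
  rewrite -map_comp; apply/eq_in_map => u _ /=; rewrite !rt /=.
  by rewrite (@encodeK w (reg_seq (s u))) ?reg_seqK // bounded_fit.
split=> [v|v]; first by rewrite half.
have tot b : \sum_(0 <= j < size [seq s x | x <- port v])
      (hop1 i b (s v) (nth (s v) [seq s x | x <- port v] j)
       + nth 0 (decode w 2 (nth [::] [seq machine_send (run A N D t.+1 u)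
            (index v (port u)) | u <- port v] j)) b) = gather s i b v.
  rewrite size_map /gather -(eq_bigl _ _ (fun u => andbT (adj v u))) -port_sum.
  rewrite (big_nth v) !big_nat; apply: eq_bigr => j /andP[_ lj].
  rewrite !(nth_map v) // half /=; congr (_ + _).
  set u := nth v _ _; have uv : adj u v by rewrite adj_sym -mem_port mem_nth.
  rewrite (@encodeK w [:: _; _]) /=; first by case: b; rewrite /machine_send /= relayE.
  have small c : relay i (s u) [seq s x | x <- port u] (index v (port u)) c < 2 ^ w.
    rewrite relayE //; apply: leq_ltn_trans relay_fit.
    apply: leq_trans (_ : \sum_(x | adj u x) Y <= _); last first.
      rewrite sum_nat_const leq_mul2r (leq_trans _ (deg_le u)) ?orbT //.
      by rewrite /degree cardsE.
    rewrite big_mkcondr; apply: leq_sum => x _.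
    by case: ifP => // _; apply: ti.
  by rewrite !small.
have -> : run A N D t.+2 v = machine_recv (run A N D t.+1 v)
  [seq machine_send (run A N D t.+1 u) (index v (port u)) | u <- port v] by [].
by rewrite {1}half ffunE -!tot.
Qed.

Lemma run_exec t : t <= size (P N D) ->
  [/\ forall v, bounded (exec s0 (take t (P N D)) v),
      every tame (drop t (P N D)) &
      forall v : vertex G, run A N D t.*2 v
        = Node w (drop t (P N D)) None (exec s0 (take t (P N D)) v)].
Proof.
elim: t => [_|t IH lt].
  by rewrite take0 drop0; split=> // v /=; rewrite ffunE.
have [bt et rt] := IH (ltnW lt).
have [i _ _] : exists2 i : instr, true & true.
  by case: (P N D) lt => // i; exists i.
rewrite (drop_nth i lt) /= in et rt; case: et => ti et.
have [_ rt2] := round_pair ti bt rt.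
have e : exec s0 (take t.+1 (P N D)) = step (exec s0 (take t (P N D))) (nth i (P N D) t).
  by rewrite (take_nth i lt) /exec -cats1 foldl_cat.
by rewrite e; split=> //; apply: step_bounded.
Qed.

(** All nodes decide in the same round, when the program is exhausted. Being undecided before that
    has to be checked at odd rounds too, which is the first half of [round_pair]. *)
Lemma machine_computes (M : {set vertex G}) : is_MIS M ->
  (forall v, joined (exec s0 (P N D) v) = (v \in M)) ->
  computes_MIS_within A G N D (size (P N D)).*2.
Proof.
move=> mis out; exists M; split=> // v; exists (size (P N D)).*2 => // r.
have [lr|gr] := ltnP r (size (P N D)).*2.
  have lh : r./2 < size (P N D) by rewrite -ltn_double (leq_ltn_trans _ lr) //
    -[leqRHS]odd_double_half leq_addl.
  have [i _ _] : exists2 i : instr, true & true.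
    by case: (P N D) lh => // i; exists i.
  have [bh eh rh] := run_exec (ltnW lh).
  rewrite (drop_nth i lh) /= in eh rh; case: eh => ti _.
  rewrite -[r]odd_double_half; case: (odd r); last by rewrite add0n rh.
  by rewrite /= (round_pair ti bh rh).1.
have [_ _ rT] := run_exec (leqnn _); rewrite drop_size take_size in rT.
have -> : run A N D r v = Node w [::] None (exec s0 (P N D) v).
  rewrite -(subnK gr); elim: (r - _) => [|k IH]; first exact: rT.
  by rewrite addSn /= IH.
by rewrite /= out.
Qed.

Lemma machine_messages : messages_within A G N D (9 * w).
Proof.
have wid t v : width (run A N D t v) = w.
  elim: t v => //= t IH v; rewrite /machine_recv.
  by case: prog => //= i Q; case: heard => [l|] /=; rewrite IH.
move=> t v p _; rewrite /= /machine_send.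
case: prog => //= i Q; case: heard => [l|]; rewrite size_encode wid //=.
by rewrite leq_mul2r orbT.
Qed.

End Correctness.

(** * Pair weights and bitwise color reduction *)

Definition loop (p : nat -> seq instr) (n : nat) : seq instr := flatten (mkseq p n).

Lemma exec_cat (G : graph) (s : {ffun vertex G -> reg}) P Q :
  exec s (P ++ Q) = exec (exec s P) Q.
Proof. exact: foldl_cat. Qed.

Lemma exec_mkseq (G : graph) (Inv : nat -> {ffun vertex G -> reg} -> Prop)
    (p : nat -> instr) n s :
  Inv 0 s -> (forall i s', i < n -> Inv i s' -> Inv i.+1 (step s' (p i))) ->
  Inv n (exec s (mkseq p n)).
Proof.
move=> I0; elim: n => [|n IH] IS //; rewrite mkseqS -cats1 exec_cat.
by apply: (IS) => //; apply: IH => i s' li; apply: IS; apply: ltnW.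
Qed.

Lemma exec_loop (G : graph) (Inv : nat -> {ffun vertex G -> reg} -> Prop)
    (p : nat -> seq instr) n s :
  Inv 0 s -> (forall i s', i < n -> Inv i s' -> Inv i.+1 (exec s' (p i))) ->
  Inv n (exec s (loop p n)).
Proof.
rewrite /loop => I0; elim: n => [|n IH] IS //.
rewrite mkseqS flatten_rcons exec_cat.
by apply: (IS) => //; apply: IH => i s' li; apply: IS; apply: ltnW.
Qed.

Definition set_lev r x := let: Reg a j l u m b h p t := r in Reg a j x u m b h p t.
Definition set_mass r x := let: Reg a j l u m b h p t := r in Reg a j l u x b h p t.
Definition set_pre r x := let: Reg a j l u m b h p t := r in Reg a j l u m b h x t.
Definition set_slot r x := let: Reg a j l u m b h p t := r in Reg a j l u m b h p x.

(* The removal of [u] is worth [2 ^ lev u], and thinning multiplies the cost of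
   a pair below [u] by [2 ^ lev v * 2 ^ lev w / (2 ^ lev u) ^ 2]; the factor [2 ^ K]
   makes the result integral. *)
Definition path_weight (K : nat) (v u w : reg) : nat :=
  [&& active v, active u, active w, lev v <= lev u & lev w <= lev u]
  * 2 ^ (K + lev v + lev w - lev u).

(** The price of a marked [v] losing to a marked neighbor [w] at or above its level: [v] then fails
    to remove any of its [updeg v] upper neighbors. The two summands make the price symmetric. *)
Definition edge_weight (K : nat) (v w : reg) : nat :=
  (active v && active w)
  * ((lev v <= lev w) * (updeg v * 2 ^ (K + lev v))
     + (lev w <= lev v) * (updeg w * 2 ^ (K + lev w))).

Definition weighted (K : nat) (phi : bool -> reg -> reg -> nat)
    (nxt : reg -> nat -> nat -> reg) : instr :=
  Instr (fun b v u w => path_weight K v u w * phi b v w)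
        (fun b v w => edge_weight K v w * phi b v w) nxt.

Definition wt (K : nat) (G : graph) (s : {ffun vertex G -> reg}) (v w : vertex G) :=
  \sum_(u | adj v u && adj u w) path_weight K (s v) (s u) (s w)
  + adj v w * edge_weight K (s v) (s w).

Lemma wtC K (G : graph) (s : {ffun vertex G -> reg}) v w : wt K s v w = wt K s w v.
Proof.
rewrite /wt adj_sym /edge_weight /path_weight; congr (_ + _ * _).
  apply: eq_big => [u|u _]; first by rewrite andbC !(adj_sym u).
  congr (nat_of_bool _ * 2 ^ _); last by rewrite addnAC.
  by case: (active (s v)); case: (active (s w)); rewrite /= ?andbF //;
     case: (active (s u)) => //=; rewrite andbC.
by rewrite addnC andbC.
Qed.

(** Exchanging the sums over middle nodes and endpoints turns what the relays report into a sum over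
    pairs; no node ever learns its distance-two neighborhood. *)
Lemma gather_weighted K (G : graph) (s : {ffun vertex G -> reg}) phi nxt b v :
  gather s (weighted K phi nxt) b v
  = \sum_(w | w != v) wt K s v w * phi b (s v) (s w).
Proof.
rewrite /gather /= big_split /= addnC.
have -> : \sum_(w | adj v w) edge_weight K (s v) (s w) * phi b (s v) (s w)
        = \sum_(w | w != v) adj v w * edge_weight K (s v) (s w) * phi b (s v) (s w).
  rewrite big_mkcond [RHS]big_mkcond; apply: eq_bigr => w _.
  case: eqP => [->|_] /=; first by rewrite adj_irr.
  by case: ifP; rewrite ?mul1n.
have -> : \sum_(u | adj v u) \sum_(w | adj u w && (w != v))
            path_weight K (s v) (s u) (s w) * phi b (s v) (s w)
        = \sum_(w | w != v) \sum_(u | adj v u && adj u w)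
            path_weight K (s v) (s u) (s w) * phi b (s v) (s w).
  rewrite (exchange_big_dep (fun w => w != v)) => [|u w _ /andP[]//] /=.
  apply: eq_bigr => w wv; apply: eq_bigl => u.
  by rewrite wv andbT.
rewrite -big_split /=; apply: eq_bigr => w _.
by rewrite /wt mulnDl big_distrl.
Qed.

(** Only the low [r * d] bits of [c] are read as a polynomial; they are replaced by the point [a]
    and the value there, [2 * r] bits in all. *)
Definition recode (r d c a : nat) : nat :=
  c %/ 2 ^ (r * d) * 2 ^ (2 * r) + (a * 2 ^ r + code r d (c %% 2 ^ (r * d)) a).

Definition low (r d : nat) (x : reg) : nat := base x %% 2 ^ (r * d).

(** Both words are read at the same point, so the clashes charged to a node depend on its own choice
    only and all nodes can choose simultaneously. *)
Definition clash (r d : nat) (x y : reg) (a : nat) : bool :=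
  (low r d x != low r d y) && (code r d (low r d x) a == code r d (low r d y) a).

(** The sum runs over the points that extend the bits fixed so far by bit [b]. Both classes have the
    same size, so comparing sums compares conditional expectations. *)
Definition bit_instr (K r d i : nat) : instr :=
  weighted K
    (fun b x y => mass y *
       \sum_(a < 2 ^ r | a == pre x + b * 2 ^ i %[mod 2 ^ i.+1]) clash r d x y a)
    (fun x c0 c1 => set_pre x ((pre x + (c1 < c0) * 2 ^ i) %% 2 ^ r)).

Definition search (K r d : nat) : seq instr := mkseq (bit_instr K r d) r.

(** Reducing [p] modulo [2 ^ r] keeps the new color in range for every bounded register, as [tame]
    demands; the values produced by [search] are already reduced. *)
Definition rebase_instr (r d : nat) : instr :=
  Instr (fun _ _ _ _ => 0) (fun _ _ _ => 0)
    (fun x _ _ => let: Reg a j l u m b h p t := x in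
       Reg a j l u m (recode r d b (p %% 2 ^ r)) h 0 t).

Definition rehue_instr (r d : nat) : instr :=
  Instr (fun _ _ _ _ => 0) (fun _ _ _ => 0)
    (fun x _ _ => let: Reg a j l u m b h p t := x in
       Reg a j l u m b (recode r d b (p %% 2 ^ r)) 0 0).

Lemma recode_inj r d c a c' a' : 0 < r -> 0 < d -> a < 2 ^ r -> a' < 2 ^ r ->
  recode r d c a = recode r d c' a' -> c != c' ->
  [/\ c %% 2 ^ (r * d) != c' %% 2 ^ (r * d), a = a' &
      code r d (c %% 2 ^ (r * d)) a = code r d (c' %% 2 ^ (r * d)) a'].
Proof.
move=> r0 d0 la la'; rewrite /recode.
have := code_lt (c %% 2 ^ (r * d)) a r0 d0.
have := code_lt (c' %% 2 ^ (r * d)) a' r0 d0.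
set k := code _ _ _ _; set k' := code _ _ _ _ => lk lk' e nc.
have pr : 0 < 2 ^ r by rewrite expn_gt0.
have lt1 b l : b < 2 ^ r -> l < 2 ^ r -> b * 2 ^ r + l < 2 ^ (2 * r).
  move=> lb ll; rewrite mul2n -addnn expnD (leq_trans (_ : _ < b.+1 * 2 ^ r)) //.
    by rewrite mulSn addnC ltn_add2r.
  by rewrite leq_mul2r lb orbT.
have div2 m n p : n < p -> (m * p + n) %/ p = m.
  by move=> lt; rewrite divnMDl ?divn_small ?addn0 // (leq_ltn_trans _ lt).
have mod2 m n p : n < p -> (m * p + n) %% p = n.
  by move=> lt; rewrite modnMDl modn_small.
move: (congr1 (fun x => x %/ 2 ^ (2 * r)) e) (congr1 (fun x => x %% 2 ^ (2 * r)) e).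
rewrite !div2 ?mod2 ?lt1 // => eh el.
move: (congr1 (fun x => x %/ 2 ^ r) el) (congr1 (fun x => x %% 2 ^ r) el).
rewrite !div2 ?mod2 // => ea ek; split=> //.
apply: contra nc => /eqP em; apply/eqP.
by rewrite (divn_eq c (2 ^ (r * d))) eh em -divn_eq.
Qed.

(** Truncated subtraction covers [b < r * d]: the high part is then zero and [2 * r] bits remain. *)
Lemma recode_lt r d b c a : 0 < r -> 0 < d -> c < 2 ^ b -> a < 2 ^ r ->
  recode r d c a < 2 ^ (b - r * d + 2 * r).
Proof.
move=> r0 d0 lc la; rewrite expnD.
have hc : (c %/ 2 ^ (r * d)).+1 <= 2 ^ (b - r * d).
  rewrite ltn_divLR ?expn_gt0 // -expnD; apply: leq_trans lc _.
  by rewrite leq_exp2l // addnC -leq_subLR.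
apply: leq_trans (_ : (c %/ 2 ^ (r * d)).+1 * 2 ^ (2 * r) <= _); last first.
  by rewrite leq_mul2r hc orbT.
rewrite /recode -[(c %/ _).+1]addn1 mulnDl mul1n ltn_add2l mul2n -addnn expnD.
apply: leq_trans (_ : a.+1 * 2 ^ r <= _); last by rewrite leq_mul2r la orbT.
by rewrite mulSn addnC ltn_add2r code_lt.
Qed.

Section Search.

Variables (K r d : nat) (G : graph) (s : {ffun vertex G -> reg}).
Hypotheses (r0 : 0 < r) (d0 : 0 < d) (pre0 : forall v, pre (s v) = 0).

Let cost v a := \sum_(w | w != v) wt K s v w * (mass (s w) * clash r d (s v) (s w) a).

Lemma wt_set_pre (f : vertex G -> nat) v w :
  wt K [ffun v => set_pre (s v) (f v)] v w = wt K s v w.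
Proof.
rewrite /wt !ffunE; congr (_ + _).
  by apply: eq_bigr => u _; rewrite !ffunE; case: (s v); case: (s u); case: (s w).
by case: (s v); case: (s w).
Qed.

(** Method of conditional expectations: each new bit splits the current class of points in two, and
    the cheaper half carries at most half of its cost. *)
Lemma search_prefix : exists f : vertex G -> nat,
  exec s (search K r d) = [ffun v => set_pre (s v) (f v)] /\
  forall v, f v < 2 ^ r /\
    2 ^ r * \sum_(a < 2 ^ r | a %% 2 ^ r == f v) cost v a <= \sum_(a < 2 ^ r) cost v a.
Proof.
pose Inv i (s' : {ffun vertex G -> reg}) := exists f : vertex G -> nat,
  s' = [ffun v => set_pre (s v) (f v)] /\
  forall v, f v < 2 ^ i /\
    2 ^ i * \sum_(a < 2 ^ r | a %% 2 ^ i == f v) cost v a <= \sum_(a < 2 ^ r) cost v a.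
apply: (exec_mkseq (Inv := Inv)) => [|i s' li [f [-> Hf]]].
  exists (fun=> 0); split.
    by apply/ffunP=> v; rewrite ffunE; move: (pre0 v); case: (s v) => /= *; congr Reg.
  move=> v; rewrite expn0 mul1n; split=> //; apply: eq_leq.
  by apply: eq_bigl => a; rewrite modn1.
pose c v (b : bool) := \sum_(a < 2 ^ r | a == f v + b * 2 ^ i %[mod 2 ^ i.+1]) cost v a.
have p2 j : 0 < 2 ^ j by rewrite expn_gt0.
have split_bits v : c v false + c v true = \sum_(a < 2 ^ r | a %% 2 ^ i == f v) cost v a.
  have [lf _] := Hf v; rewrite [RHS]big_mkcond /c.
  rewrite [X in X + _]big_mkcond [X in _ + X]big_mkcond -big_split.
  apply: eq_bigr => a _ /=; rewrite mul0n mul1n addn0.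
  have -> : a %% 2 ^ i = (a %% 2 ^ i.+1) %% 2 ^ i.
    by rewrite modn_dvdm // expnS dvdn_mull.
  rewrite (@modn_small (f v)) ?(@modn_small (f v + _)); try (rewrite expnS; lia).
  have := ltn_pmod a (p2 i.+1); rewrite expnS; set y := a %% _ => ly.
  have [ly'|gy] := ltnP y (2 ^ i).
    rewrite modn_small //; case: eqP => // _; case: eqP => //; lia.
  have -> : y %% 2 ^ i = y - 2 ^ i.
    by rewrite -{1}(subnK gy) modnDr modn_small //; lia.
  by case: eqP => [?|?]; case: eqP => [?|?]; case: eqP => // ?; lia.
pose g v := f v + (c v true < c v false) * 2 ^ i.
have lg v : g v < 2 ^ i.+1.
  have [lf _] := Hf v; rewrite /g expnS mul2n -addnn.
  by case: (c v true < _); lia.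
have gE (b : bool) v : gather [ffun v => set_pre (s v) (f v)] (bit_instr K r d i) b v = c v b.
  rewrite /bit_instr gather_weighted /c /cost exchange_big; apply: eq_bigr => w _.
  rewrite wt_set_pre !ffunE -big_distrr; congr (_ * _).
  case: (s v) => va vj vl vu vm vb vh vp vt; case: (s w) => wa wj wl wu wm wb wh wp wt' /=.
  by rewrite big_distrr.
exists g; split.
  apply/ffunP=> v; rewrite /step !ffunE !gE /=.
  case: (s v) => va vj vl vu vm vb vh vp vt /=; congr Reg; rewrite -/(g v) modn_small //.
  by rewrite (leq_trans (lg v)) // leq_exp2l.
move=> v; split=> //; have [lf lc] := Hf v; apply: leq_trans lc.
rewrite -split_bits [X in X * _]expnSr -mulnA leq_mul2l; apply/orP; right.
have -> : \sum_(a < 2 ^ r | a %% 2 ^ i.+1 == g v) cost v a = c v (c v true < c v false).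
  by apply: eq_bigl => a; rewrite -{1}(modn_small (lg v)).
rewrite mul2n -addnn; case: (ltnP (c v true) (c v false)) => h.
  by rewrite leq_add2r ltnW.
by rewrite leq_add2l.
Qed.

(** After [r] bits the class is one point, no worse than average; by [code_agree] each pair clashes
    at no more than [d] of the [2 ^ r] points. *)
Lemma search_ok : exists f : vertex G -> nat,
  exec s (search K r d) = [ffun v => set_pre (s v) (f v)] /\
  forall v, f v < 2 ^ r /\
    2 ^ r * cost v (f v) <= d * \sum_(w | w != v) wt K s v w * mass (s w).
Proof.
have [f [-> Hf]] := search_prefix; exists f; split=> // v.
have [lf lc] := Hf v; split=> //; move: lc.
rewrite (big_pred1 (Ordinal lf)) => [|a] /=; last first.
  by rewrite modn_small ?ltn_ord // -val_eqE.
move=> lc; apply: leq_trans lc _; rewrite exchange_big big_distrr /=.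
apply: leq_sum => w _; rewrite mulnCA -big_distrr leq_mul2l; apply/orP; right.
rewrite mulnC -big_distrr leq_mul2l; apply/orP; right.
rewrite /clash; have [_|nl] := eqVneq (low r d (s v)) (low r d (s w)).
  by rewrite big1.
by apply: code_agree => //; rewrite ltn_pmod ?expn_gt0.
Qed.

(** Equal new colors contain equal evaluation points, so every collision is already a clash at the
    point of [v], whatever the others chose. *)
Lemma recode_clash (f : vertex G -> nat) v :
  (forall v, f v < 2 ^ r) ->
  \sum_(w | w != v) wt K s v w * mass (s w) *
     ((base (s v) != base (s w)) &&
      (recode r d (base (s v)) (f v) == recode r d (base (s w)) (f w)))
  <= cost v (f v).
Proof.
move=> lf; apply: leq_sum => w _; rewrite -mulnA leq_mul2l; apply/orP; right.
rewrite leq_mul2l; apply/orP; right; case: andP => // -[nb /eqP e].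
have [nl ef ec] := recode_inj r0 d0 (lf v) (lf w) e nb.
by rewrite /clash /low nl /= ec ef eqxx.
Qed.

End Search.

(** * Defective coloring with few colors *)

Definition guess (rf : nat) (x : reg) (t : nat) : nat := code rf 4 (hue x) t.

(* [slot] is 0 while a node is undecided and one plus its final color after. *)
Definition taken (rf t : nat) (x y : reg) : bool :=
  (hue x != hue y) &&
  (if slot y is c.+1 then c == guess rf x t else guess rf y t == guess rf x t).

(** The bit selects between two sums: [c0] is the weight of conflicts with the current guess and
    [c1] the total weight. A guess is kept when its conflicts are at most an [8 / 2 ^ rf]
    fraction. *)
Definition try_instr (K rf t : nat) : instr :=
  weighted K (fun b x y => mass y * (b || taken rf t x y))
    (fun x c0 c1 => if (slot x == 0) && (2 ^ rf * c0 <= 8 * c1)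
                    then set_slot x (guess rf x t).+1 else x).

Section Slots.

Variables (K rf : nat) (G : graph) (s : {ffun vertex G -> reg}).
Hypotheses (rf0 : 0 < rf) (slot0 : forall v, slot (s v) = 0).
Hypothesis hue_lt : forall v, hue (s v) < 2 ^ (rf * 4).

Let q := 2 ^ rf.
Let tot v := \sum_(w | w != v) wt K s v w * mass (s w).
Let gs v t := guess rf (s v) t.

Let pw v w := mass (s v) * (wt K s v w * mass (s w)).
Let pwC v w : pw v w = pw w v.
Proof. by rewrite /pw (wtC K s v w); lia. Qed.

Lemma wt_set_slot (f : vertex G -> nat) v w :
  wt K [ffun v => set_slot (s v) (f v)] v w = wt K s v w.
Proof.
rewrite /wt !ffunE; congr (_ + _).
  by apply: eq_bigr => u _; rewrite !ffunE; case: (s v); case: (s u); case: (s w).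
by case: (s v); case: (s w).
Qed.

Let tk (g : vertex G -> nat) t v w :=
  (hue (s v) != hue (s w)) &&
  (if g w is c.+1 then c == gs v t else gs w t == gs v t).

Let cost g t v := \sum_(w | w != v) wt K s v w * (mass (s w) * tk g t v w).

Let upd g t v :=
  if (g v == 0) && (q * cost g t v <= 8 * tot v) then (gs v t).+1 else g v.

Lemma try_step g t :
  step [ffun v => set_slot (s v) (g v)] (try_instr K rf t)
  = [ffun v => set_slot (s v) (upd g t v)].
Proof.
apply/ffunP=> v; rewrite /step !ffunE.
have -> : gather [ffun v => set_slot (s v) (g v)] (try_instr K rf t) false v = cost g t v.
  rewrite gather_weighted; apply: eq_bigr => w _; rewrite wt_set_slot !ffunE /=.
  congr (_ * (_ * nat_of_bool _)); first by case: (s w).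
  rewrite /taken /tk /gs /guess.
  by case: (s v) => *; case: (s w) => * /=.
have -> : gather [ffun v => set_slot (s v) (g v)] (try_instr K rf t) true v = tot v.
  rewrite gather_weighted; apply: eq_bigr => w _; rewrite wt_set_slot !ffunE /=.
  by congr (_ * _); rewrite muln1; case: (s w).
rewrite /upd /gs /guess /=; case: (s v) => va vj vl vu vm vb vh vp vt /=.
by case: ifP.
Qed.

Let same (g : vertex G -> nat) v w :=
  [&& 0 < g v, g v == g w & hue (s v) != hue (s w)].

(** A pair that becomes monochromatic is charged to an endpoint settling in that round, at most
    [8 * tot v / q] per settling node; both orders of a pair are summed, hence 16. No node rejects
    all [q] guesses, since the average conflict is at most the threshold. *)
Lemma slots_ok : exists f : vertex G -> nat,
  [/\ exec s (mkseq (try_instr K rf) q) = [ffun v => set_slot (s v) (f v)],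
      forall v, 0 < f v <= q &
      q * \sum_v \sum_(w | w != v) pw v w * ((hue (s v) != hue (s w)) && (f v == f w))
      <= 16 * \sum_v \sum_(w | w != v) pw v w].
Proof.
pose Inv t (s' : {ffun vertex G -> reg}) := exists g : vertex G -> nat,
  [/\ s' = [ffun v => set_slot (s v) (g v)], forall v, g v <= q,
      q * \sum_v \sum_(w | w != v) pw v w * same g v w
        <= 16 * \sum_v mass (s v) * tot v * (0 < g v) &
      (* The successor records that rejection is strict. The last sum also counts points tried
         before [w] settled, so it can only grow when [g] is updated. *)
      forall v, g v = 0 -> t * (8 * tot v).+1 <= q * \sum_(w | w != v)
        wt K s v w * mass (s w) * ((hue (s v) != hue (s w)) *
          (\sum_(a < t) (gs w a == gs v a) + \sum_(a < t) (g w == (gs v a).+1)))].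
(* A new monochromatic pair needs an endpoint settling now, and that endpoint has counted the
   conflict. *)
have tkI g t v w : same (upd g t) v w <= same g v w
    + ((g v == 0) && (0 < upd g t v)) * tk g t v w
    + ((g w == 0) && (0 < upd g t w)) * tk g t w v.
  rewrite /same /tk /upd [hue (s w) == _]eq_sym.
  case: (hue (s v) != hue (s w)); rewrite ?andbT ?andbF //=.
  case ev: (g v) => [|x]; case ew: (g w) => [|y] /=;
    try (case: ifP => _); try (case: ifP => _); rewrite /= ?eqSS; lia.
have : Inv q (exec s (mkseq (try_instr K rf) q)).
  apply: exec_mkseq => [|t s' lt [g [-> gq Ha Hb]]].
    exists (fun=> 0); split; [ | by [] | | by move=> v _; rewrite mul0n].
      by apply/ffunP=> v; rewrite ffunE; move: (slot0 v); case: (s v) => /= *; congr Reg.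
    rewrite (_ : \sum_v _ = 0) ?muln0 // big1 // => v _; rewrite big1 // => w _.
    by rewrite muln0.
  exists (upd g t); split; first exact: try_step.
  - by move=> v; rewrite /upd; case: ifP => // _; apply: code_lt.
  - pose N v := (g v == 0) && (0 < upd g t v).
    have Nc v : N v * (mass (s v) * (q * cost g t v)) <= N v * (mass (s v) * (8 * tot v)).
      rewrite /N /upd; case: eqP => //= ->; case: ifP => //= h.
      by rewrite !leq_mul2l h !orbT.
    have S2 : \sum_v \sum_(w | w != v) pw v w * (N v * tk g t v w)
            = \sum_v N v * (mass (s v) * cost g t v).
      apply: eq_bigr => v _; rewrite /cost !big_distrr.
      by apply: eq_bigr => w _; rewrite /pw /=; lia.
    have S3 : \sum_v \sum_(w | w != v) pw v w * (N w * tk g t w v)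
            = \sum_v N v * (mass (s v) * cost g t v).
      rewrite -S2 (exchange_big_dep xpredT) //=; apply: eq_bigr => v _.
      by apply: eq_big => [w|w _]; rewrite 1?eq_sym // pwC.
    apply: (@leq_trans (q * \sum_v \sum_(w | w != v) pw v w * same g v w
        + 2 * \sum_v N v * (mass (s v) * (q * cost g t v)))).
      have -> : \sum_v N v * (mass (s v) * (q * cost g t v))
              = q * \sum_v N v * (mass (s v) * cost g t v).
        by rewrite big_distrr; apply: eq_bigr => v _ /=; lia.
      rewrite mulnCA -mulnDr leq_mul2l; apply/orP; right.
      rewrite mul2n -addnn -{1}S2 -S3 -!big_split; apply: leq_sum => v _ /=.
      rewrite -!big_split; apply: leq_sum => w _ /=; rewrite -!mulnDr leq_mul2l addnA.
      by rewrite tkI orbT.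
    have S4 : \sum_v N v * (mass (s v) * (q * cost g t v))
            <= \sum_v N v * (mass (s v) * (8 * tot v)) by apply: leq_sum => v _.
    apply: (leq_trans (leq_add Ha (leq_mul (leqnn 2) S4))).
    rewrite !big_distrr -big_split; apply: leq_sum => v _ /=.
    have -> : (0 < upd g t v) = (0 < g v) + N v :> nat.
      by rewrite /N /upd; case: (g v).
    by apply: eq_leq; lia.
  - move=> v; rewrite {1}/upd; case: ifP => // /negbT nd g0.
    rewrite g0 /= -ltnNge in nd.
    rewrite mulSn addnC; apply: leq_trans (leq_add (Hb v g0) nd) _.
    rewrite -mulnDr leq_mul2l -big_split; apply/orP; right; apply: leq_sum => w _ /=.
    rewrite [X in _ + X <= _]mulnA -mulnDr leq_mul2l; apply/orP; right.
    rewrite !big_ord_recr /tk; case: (_ != _) => //=; rewrite !mul1n.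
    rewrite addnACA leq_add //.
      apply: leq_add => //; apply: leq_sum => a _.
      by rewrite /upd; case: (g w) => [|x].
    rewrite /upd; case: (g w) => [|x] /=; first by rewrite leq_addr.
    by rewrite eqSS leq_addl.
move=> [f [-> fq Ha Hb]].
have f0 v : 0 < f v.
  rewrite lt0n; apply/negP=> /eqP /Hb; rewrite leqNgt => /negP; apply.
  rewrite ltn_mul2l expn_gt0 /= ltnS big_distrr; apply: leq_sum => w _.
  rewrite mulnC leq_mul2r; apply/orP; right.
  (* The threshold is [8 = 4 + 4]: over all points, the quartic of [v] meets that of [w] at most 4
     times and takes the final color of [w] at most 4 times. *)
  have [//|nh] := eqVneq (hue (s v)) (hue (s w)).
  rewrite mul1n; apply: (@leq_add _ _ 4 4).
    by apply: code_agree => //; rewrite eq_sym.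
  have hit := @code_hit rf 4 (hue (s v)) (f w).-1 rf0 isT.
  apply: leq_trans hit; apply: leq_sum => a _.
  by case: eqP => // ->; rewrite eqxx.
exists f; split=> // [v|]; first by rewrite f0 fq.
have -> : \sum_v \sum_(w | w != v) pw v w = \sum_v mass (s v) * tot v * (0 < f v).
  by apply: eq_bigr => v _; rewrite f0 muln1 big_distrr.
apply: leq_trans Ha; rewrite leq_mul2l; apply/orP; right.
apply: leq_sum => v _; apply: leq_sum => w _; rewrite leq_mul2l /same f0 /=.
by rewrite andbC leqnn orbT.
Qed.

End Slots.

(** * One rounding step *)

Lemma quad_split (V : finType) (b : V -> V -> nat) (T : pred V) (X : V -> nat) :
  (forall v w, b v w = b w v) -> (forall v w, T v -> T w -> b v w = 0) ->
  \sum_v \sum_w X v * (b v w * X w)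
  = 2 * \sum_(v | T v) X v * (\sum_(w | ~~ T w) b v w * X w)
    + \sum_(v | ~~ T v) \sum_(w | ~~ T w) X v * (b v w * X w).
Proof.
move=> bC bT; rewrite (bigID T) /=.
have inner v : T v -> \sum_w X v * (b v w * X w) = X v * (\sum_(w | ~~ T w) b v w * X w).
  move=> Tv; rewrite (bigID T) /= big1 ?add0n ?big_distrr // => w Tw.
  by rewrite bT // muln0.
rewrite (eq_bigr _ inner) mul2n -addnn -addnA; congr (_ + _).
rewrite (eq_bigr _ (fun v _ => bigID T _ _)) big_split /=; congr (_ + _).
rewrite exchange_big; apply: eq_bigr => v Tv; rewrite big_distrr.
by apply: eq_bigr => w _; rewrite /= (bC w); lia.
Qed.

(* [T] is independent for [b], so the objective is affine in the values on [T]
   and every node of [T] may move in the direction of its partial derivative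
   independently of the others. *)
Lemma quad_step (V : finType) (b : V -> V -> nat) (T : pred V) (l : nat)
    (A X X' : V -> nat) :
  (forall v w, b v w = b w v) -> (forall v w, T v -> T w -> b v w = 0) ->
  (forall v, ~~ T v -> X' v = X v) ->
  (forall v, T v -> X v < X' v -> l * (\sum_w b v w * X w) <= A v) ->
  (forall v, T v -> X' v < X v -> A v <= l * (\sum_w b v w * X w)) ->
  2 * (\sum_v A v * X v) + l * \sum_v \sum_w X' v * (b v w * X' w)
  <= 2 * (\sum_v A v * X' v) + l * \sum_v \sum_w X v * (b v w * X w).
Proof.
move=> bC bT off up down; rewrite !(quad_split _ bC bT).
have R : \sum_(v | ~~ T v) \sum_(w | ~~ T w) X' v * (b v w * X' w)
       = \sum_(v | ~~ T v) \sum_(w | ~~ T w) X v * (b v w * X w).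
  by apply: eq_bigr => v Tv; apply: eq_bigr => w Tw; rewrite !off.
pose S v := \sum_(w | ~~ T w) b v w * X w.
have SE v : T v -> \sum_w b v w * X w = S v.
  move=> Tv; rewrite (bigID T) /= big1 ?add0n // => w Tw.
  by rewrite bT.
have S' : \sum_(v | T v) X' v * (\sum_(w | ~~ T w) b v w * X' w)
        = \sum_(v | T v) X' v * S v.
  by apply: eq_bigr => v _; congr (_ * _); apply: eq_bigr => w Tw; rewrite off.
have A' : \sum_(v | ~~ T v) A v * X' v = \sum_(v | ~~ T v) A v * X v.
  by apply: eq_bigr => v Tv; rewrite off.
have H : \sum_(v | T v) A v * X v + l * \sum_(v | T v) X' v * S v
      <= \sum_(v | T v) A v * X' v + l * \sum_(v | T v) X v * S v.
  rewrite !big_distrr -!big_split; apply: leq_sum => v Tv /=.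
  have := up v Tv; have := down v Tv; rewrite SE //.
  case: (ltngtP (X v) (X' v)) => [lt _ /(_ isT) le|lt /(_ isT) le _|->//].
    by rewrite -(subnKC (ltnW lt)); move: (X' v - X v) => e; nia.
  by rewrite -(subnKC (ltnW lt)); move: (X v - X' v) => e; nia.
rewrite R S' (bigID T) [X in _ <= 2 * X + _](bigID T) /= A' -/S.
have -> : \sum_(v | T v) X v * (\sum_(w | ~~ T w) b v w * X w)
        = \sum_(v | T v) X v * S v by [].
lia.
Qed.

(** The test is the sign of the partial derivative of the objective, scaled by [K + 2] to stay
    integral. Pairs with equal slots are left out, which makes each slot class independent. *)
Definition round_instr (K i t : nat) : instr :=
  weighted K (fun _ x y => mass y * (slot x != slot y))
    (fun x c _ => if (slot x == t.+1) && (mass x == 2 ^ i) then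
       set_mass x (if (2 * (K + 2) - i.+1) * c
                      <= (K + 2) * (updeg x * 2 ^ (2 * K + 2 + lev x))
                   then 2 ^ i.+1 else 0) else x).

Section Rounding.

Variables (K i q : nat) (G : graph) (s : {ffun vertex G -> reg}).
Hypothesis slot_q : forall v, 0 < slot (s v) <= q.

Let M := K + 2.
Let m v := mass (s v).
Let b v w := (w != v) * (wt K s v w * (slot (s v) != slot (s w))).
Let A v := M * (updeg (s v) * 2 ^ (2 * K + 2 + lev (s v))).

Lemma wt_set_mass (f : vertex G -> nat) v w :
  wt K [ffun v => set_mass (s v) (f v)] v w = wt K s v w.
Proof.
rewrite /wt !ffunE; congr (_ + _).
  by apply: eq_bigr => u _; rewrite !ffunE; case: (s v); case: (s u); case: (s w).
by case: (s v); case: (s w).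
Qed.

Lemma round_ok : exists X : vertex G -> nat,
  [/\ exec s (mkseq (round_instr K i) q) = [ffun v => set_mass (s v) (X v)],
      forall v, if m v == 2 ^ i then (X v == 0) || (X v == 2 ^ i.+1) else X v == m v &
      2 * (\sum_v A v * m v)
        + (2 * M - i.+1) * \sum_v \sum_w X v * (b v w * X w)
      <= 2 * (\sum_v A v * X v)
        + (2 * M - i.+1) * \sum_v \sum_w m v * (b v w * m w)].
Proof.
pose Inv t (s' : {ffun vertex G -> reg}) := exists X : vertex G -> nat,
  [/\ s' = [ffun v => set_mass (s v) (X v)],
      forall v, if (slot (s v) <= t) && (m v == 2 ^ i)
                then (X v == 0) || (X v == 2 ^ i.+1) else X v == m v &
      2 * (\sum_v A v * m v)
        + (2 * M - i.+1) * \sum_v \sum_w X v * (b v w * X w)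
      <= 2 * (\sum_v A v * X v)
        + (2 * M - i.+1) * \sum_v \sum_w m v * (b v w * m w)].
have : Inv q (exec s (mkseq (round_instr K i) q)).
  apply: exec_mkseq => [|t s' lt [X [-> HX IX]]].
    exists m; split=> // [|v]; last first.
      by case/andP: (slot_q v) => + _; rewrite ltnNge => /negbTE ->; rewrite eqxx.
    by apply/ffunP=> v; rewrite ffunE /m; case: (s v).
  pose c v := \sum_w b v w * X w.
  pose T v := (slot (s v) == t.+1) && (m v == 2 ^ i).
  pose X' v := if T v then if (2 * M - i.+1) * c v <= A v then 2 ^ i.+1 else 0 else X v.
  have XT v : T v -> X v = 2 ^ i.
    by case/andP=> /eqP e /eqP em; move: (HX v); rewrite e ltnn /= => /eqP ->.
  (* A node moves only in the round of its own slot, so its current mass is still the original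
     one. *)
  have XN v : (X v == 2 ^ i) && (slot (s v) == t.+1) = T v.
    rewrite /T andbC; have [e|//] := eqVneq (slot (s v)) t.+1.
    by move: (HX v); rewrite e ltnn /= => /eqP ->.
  exists X'; split.
  - apply/ffunP=> v.
    have gE : gather [ffun v => set_mass (s v) (X v)] (round_instr K i t) false v = c v.
      rewrite gather_weighted big_mkcond; apply: eq_bigr => w _; rewrite wt_set_mass !ffunE /b.
      case: (w != v) => //=; rewrite mul1n -mulnA; congr (_ * _); rewrite mulnC.
      by case: (s v); case: (s w).
    rewrite /step !ffunE gE /X' /=.
    have <- : (slot (set_mass (s v) (X v)) == t.+1)
           && (mass (set_mass (s v) (X v)) == 2 ^ i) = T v.
      by rewrite -XN andbC; case: (s v).
    have -> : (K + 2) * (updeg (set_mass (s v) (X v))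
         * 2 ^ (2 * K + 2 + lev (set_mass (s v) (X v)))) = A v.
      by rewrite /A; case: (s v).
    by case: ifP => _ //; case: (s v).
  - move=> v; rewrite /X'; case Tv: (T v).
      case/andP: (Tv) => /eqP -> ->.
      by rewrite leqnn /=; case: (_ * c v <= _); rewrite eqxx ?orbT.
    have [e|ne] := eqVneq (slot (s v)) t.+1.
      by move: (HX v) Tv; rewrite /T e ltnn eqxx /= => hx ->; rewrite andbF.
    by move: (HX v); rewrite [_ <= t.+1]leq_eqVlt (negbTE ne) ltnS.
  have := @quad_step _ b T (2 * M - i.+1) A X X'; set l := 2 * M - _ in IX *.
  move=> /(_ _ _ _ _ _) step.
  suff : 2 * (\sum_v A v * X v) + l * \sum_v \sum_w X' v * (b v w * X' w)
      <= 2 * (\sum_v A v * X' v) + l * \sum_v \sum_w X v * (b v w * X w).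
    by move: IX; lia.
  apply: step => [v w|v w|v|v Tv|v Tv].
  - by rewrite /b [w == v]eq_sym (wtC K s v w) [slot (s v) == _]eq_sym.
  - by move=> /andP[/eqP e _] /andP[/eqP e' _]; rewrite /b e e' eqxx !muln0.
  - by move=> /negbTE Tv; rewrite /X' Tv.
  - by rewrite /X' Tv; case: ifP.
  rewrite /X' Tv XT //; case: (leqP (l * c v) (A v)) => [_|h _]; last exact: ltnW.
  by rewrite ltn_exp2l // ltnNge leqnSn.
move=> [X [-> HX IX]]; exists X; split=> // v; move: (HX v).
by case/andP: (slot_q v) => _ ->.
Qed.

End Rounding.

(* [2 ^ base_bits] exceeds three times (the degree of the code) the initial pair
   weight around a node, so that the first coloring has no conflicts; with
   [2 ^ slot_bits >= 192 * M] for [M = K + 2], each of the two recolorings of a step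
   adds at most [1 / (12 * M)] to the monochromatic fraction of the cost. *)
Definition base_bits (K : nat) : nat := 3 * K + 3.
Definition slot_bits (K : nat) : nat := up_log 2 (192 * (K + 2)).

Definition rounding_step (K i : nat) : seq instr :=
  search K (2 * slot_bits K) (2 * base_bits K)
  ++ rehue_instr (2 * slot_bits K) (2 * base_bits K)
  :: mkseq (try_instr K (slot_bits K)) (2 ^ slot_bits K)
  ++ mkseq (round_instr K i) (2 ^ slot_bits K).

(** * Combined effect of recoloring and rounding on the objective *)

Definition stat (r : reg) := (active r, joined r, lev r, updeg r, base r).

Lemma wt_stat K (G : graph) (s s' : {ffun vertex G -> reg}) :
  (forall v, stat (s' v) = stat (s v)) -> wt K s' =2 wt K s.
Proof.
have E r r' : stat r' = stat r ->
    [/\ active r' = active r, lev r' = lev r & updeg r' = updeg r] by case.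
move=> H v w; rewrite /wt /edge_weight /path_weight.
have [-> -> ->] := E _ _ (H v); have [-> -> ->] := E _ _ (H w).
by congr (_ + _); apply: eq_bigr => u _; have [-> -> _] := E _ _ (H u).
Qed.

Section RoundingStep.

Variables (K i : nat) (G : graph) (s : {ffun vertex G -> reg}).
Hypotheses (pre0 : forall v, pre (s v) = 0).
Hypothesis base_lt : forall v, base (s v) < 2 ^ (2 * base_bits K).
Hypothesis base_proper : forall v w, w != v -> 0 < wt K s v w -> base (s v) != base (s w).

Let M := K + 2.
Let m v := mass (s v).
Let A v := M * (updeg (s v) * 2 ^ (2 * K + 2 + lev (s v))).

Definition pair_cost (X : vertex G -> nat) : nat :=
  \sum_v \sum_(w | w != v) X v * (wt K s v w * X w).

(** Rounding ignores monochromatic pairs. As masses at most double, their cost grows from [Cs m] to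
    at most [4 * Cs m]; with weight [l <= 2 * M] the excess is at most
    [6 * M * Cs m <= pair_cost m], which one unit of weight decrease pays for. *)
Lemma rounding_step_ok : let s' := exec s (rounding_step K i) in
  [/\ forall v, stat (s' v) = stat (s v), forall v, pre (s' v) = 0,
      forall v, if m v == 2 ^ i then (mass (s' v) == 0) || (mass (s' v) == 2 ^ i.+1)
                else mass (s' v) == m v &
      2 * (\sum_v A v * m v)
        + (2 * M - i.+1) * pair_cost (fun v => mass (s' v))
      <= 2 * (\sum_v A v * mass (s' v)) + (2 * M - i) * pair_cost m].
Proof.
set rf := slot_bits K; set d := 2 * base_bits K.
have q_ge : 192 * M <= 2 ^ rf by apply: up_logP.
have rf0 : 0 < rf by rewrite /rf /slot_bits up_log_gt0; lia.
have r0 : 0 < 2 * rf by rewrite muln_gt0.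
have d0 : 0 < d by rewrite /d /base_bits; lia.
rewrite /rounding_step -/rf -/d exec_cat.
have [f [-> Hf]] := search_ok K r0 d0 pre0.
rewrite -cat1s !exec_cat.
pose nc v := recode (2 * rf) d (base (s v)) (f v).
set s2 := exec _ [:: _].
have s2E v : [/\ stat (s2 v) = stat (s v), mass (s2 v) = m v, hue (s2 v) = nc v,
                 pre (s2 v) = 0 & slot (s2 v) = 0].
  have fm := modn_small (Hf v).1.
  by rewrite /s2 /= /step !ffunE /nc /m; case: (s v) => *; split=> //=; rewrite fm.
have wt2 : wt K s2 =2 wt K s by apply: wt_stat => v; case: (s2E v).
have nc_lt v : hue (s2 v) < 2 ^ (rf * 4).
  have [_ _ -> _ _] := s2E v; rewrite /nc (_ : rf * 4 = 2 * (2 * rf)); last by lia.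
  have lb : base (s v) < 2 ^ (2 * rf * d).
    by rewrite (leq_trans (base_lt v)) // leq_exp2l // leq_pmull.
  by have := recode_lt r0 d0 lb (Hf v).1; rewrite subnn.
have [g [-> gq Hg]] := slots_ok K rf0 (fun v => let: And5 _ _ _ _ e := s2E v in e) nc_lt.
set s3 := [ffun v => set_slot (s2 v) (g v)].
have s3E v : [/\ stat (s3 v) = stat (s v), mass (s3 v) = m v, slot (s3 v) = g v & pre (s3 v) = 0].
  by have [<- <- _ <- _] := s2E v; rewrite /s3 ffunE; case: (s2 v).
have wt3 : wt K s3 =2 wt K s by apply: wt_stat => v; case: (s3E v).
have sq v : 0 < slot (s3 v) <= 2 ^ rf by have [_ _ -> _] := s3E v.
have [X [-> HX IX]] := round_ok K i sq.
set s4 := finfun _; cbv zeta.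
have s4E v : [/\ stat (s4 v) = stat (s v), mass (s4 v) = X v & pre (s4 v) = 0].
  by have [<- _ _ <-] := s3E v; rewrite /s4 ffunE; case: (s3 v).
split=> [v|v|v|]; try by case: (s4E v).
  by have [_ -> _] := s4E v; move: (HX v); have [_ -> _ _] := s3E v.
have mE : \sum_v A v * mass (s4 v) = \sum_v A v * X v.
  by apply: eq_bigr => v _; have [_ -> _] := s4E v.
have cE : pair_cost (fun v => mass (s4 v)) = pair_cost X.
  by apply: eq_bigr => v _; apply: eq_bigr => w _; have [_ -> _] := s4E v; have [_ -> _] := s4E w.
rewrite {}mE {}cE.
pose Cs (Z : vertex G -> nat) := \sum_v \sum_(w | w != v) Z v * (wt K s v w * Z w) * (g v == g w).
pose Cn (Z : vertex G -> nat) := \sum_v \sum_(w | w != v) Z v * (wt K s v w * Z w) * (g v != g w).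
have CE Z : pair_cost Z = Cs Z + Cn Z.
  rewrite /pair_cost /Cs /Cn -big_split; apply: eq_bigr => v _.
  rewrite -big_split; apply: eq_bigr => w _ /=.
  by case: eqP => _; rewrite ?muln0 ?muln1 ?addn0.
have CnE Z : \sum_v \sum_w
    Z v * ((w != v) * (wt K s3 v w * (slot (s3 v) != slot (s3 w))) * Z w) = Cn Z.
  apply: eq_bigr => v _; rewrite [RHS]big_mkcond; apply: eq_bigr => w _.
  have [_ _ -> _] := s3E v; have [_ _ -> _] := s3E w; rewrite wt3.
  by case: ifP => _ /=; lia.
have AE Z : \sum_v (K + 2) * (updeg (s3 v) * 2 ^ (2 * K + 2 + lev (s3 v))) * Z v
          = \sum_v A v * Z v.
  apply: eq_bigr => v _; have [e _ _ _] := s3E v; rewrite /A.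
  by case: e => _ _ -> -> _.
have ME Y : (forall v, Y v = m v) -> Cn Y = Cn m /\ \sum_v A v * Y v = \sum_v A v * m v.
  move=> e; split; last by apply: eq_bigr => v _; rewrite e.
  by apply: eq_bigr => v _; apply: eq_bigr => w _; rewrite !e.
move: IX; rewrite !CnE !AE.
have [-> ->] := ME (fun v => mass (s3 v)) (fun v => let: And4 _ e _ _ := s3E v in e).
have Cs4 : Cs X <= 4 * Cs m.
  have X2 v : X v <= 2 * m v.
    move: (HX v); have [_ -> _ _] := s3E v.
    by case: eqP => [-> /orP[]|_] /eqP ->; rewrite ?expnS //; lia.
  rewrite /Cs big_distrr; apply: leq_sum => v _; rewrite big_distrr; apply: leq_sum => w _ /=.
  case: (g v == g w); rewrite ?muln0 // !muln1.
  have := leq_mul (X2 v) (leq_mul (leqnn (wt K s v w)) (X2 w)); lia.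
(* A pair with equal slots either kept distinct hues ([CA], second recoloring) or already lost them
   ([CB], first recoloring). *)
have Csm : 6 * M * Cs m <= pair_cost m.
  pose CA := \sum_v \sum_(w | w != v) m v * (wt K s v w * m w) * ((nc v != nc w) && (g v == g w)).
  pose CB := \sum_v \sum_(w | w != v) m v * (wt K s v w * m w) * (nc v == nc w).
  have hA : 2 ^ rf * CA <= 16 * pair_cost m.
    have eA : CA = \sum_v \sum_(w | w != v) mass (s2 v) * (wt K s2 v w * mass (s2 w))
        * ((hue (s2 v) != hue (s2 w)) && (g v == g w)).
      apply: eq_bigr => v _; apply: eq_bigr => w _; rewrite wt2.
      by have [_ -> -> _ _] := s2E v; have [_ -> -> _ _] := s2E w.
    rewrite eA; apply: leq_trans Hg _; rewrite leq_mul2l; apply/orP; right.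
    apply: leq_sum => v _; apply: leq_sum => w _; rewrite wt2.
    by have [_ -> _ _ _] := s2E v; have [_ -> _ _ _] := s2E w.
  have hB : 2 ^ (2 * rf) * CB <= d * pair_cost m.
    rewrite /CB /pair_cost !big_distrr; apply: leq_sum => v _.
    rewrite -!big_distrr /=.
    have -> : \sum_(w | w != v) m v * (wt K s v w * m w) * (nc v == nc w)
      = m v * \sum_(w | w != v) wt K s v w * m w *
          ((base (s v) != base (s w)) && (nc v == nc w)).
      rewrite big_distrr; apply: eq_bigr => w wv /=.
      case: (posnP (wt K s v w)) => [->|/(base_proper wv) ->]; lia.
    have [_ hv] := Hf v.
    have := leq_trans (leq_mul (leqnn (2 ^ (2 * rf)))
      (@recode_clash K (2 * rf) d G s r0 d0 f v (fun v => (Hf v).1))) hv.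
    by move=> h; rewrite !(mulnCA _ (m v)) leq_mul2l h orbT.
  have hs : Cs m <= CA + CB.
    rewrite -big_split; apply: leq_sum => v _; rewrite -big_split; apply: leq_sum => w _ /=.
    by rewrite -mulnDr leq_mul2l; case: (nc v == nc w); case: (g v == g w); rewrite orbT.
  have sq2 : 12 * M * d <= 2 ^ (2 * rf).
    have -> : 2 ^ (2 * rf) = 2 ^ rf * 2 ^ rf by rewrite -expnD addnn -mul2n.
    apply: leq_trans (leq_mul q_ge q_ge).
    have dM : d <= 6 * M by rewrite /d /base_bits /M; lia.
    by apply: leq_trans (leq_mul (leqnn (12 * M)) dM) _; nia.
  have kA : 12 * M * CA <= pair_cost m.
    have := leq_trans (leq_mul q_ge (leqnn CA)) hA; lia.
  have kB : 12 * M * CB <= pair_cost m.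
    rewrite -(leq_pmul2l d0); apply: leq_trans hB.
    by rewrite mulnA [d * _]mulnC leq_mul2r sq2 orbT.
  have := leq_mul (leqnn (6 * M)) hs; lia.
rewrite !CE; move: Csm; rewrite CE; set l := 2 * M - i.+1.
(* Since [i] is arbitrary here, truncated subtraction may make both weights zero. *)
have [li|li] : 2 * M - i = l.+1 /\ l <= 2 * M \/ 2 * M - i = 0 /\ l = 0 by rewrite /l; lia.
  case: li => -> ll h IX.
  have : l * Cs X <= l * (4 * Cs m) by rewrite leq_mul2l Cs4 orbT.
  have : l * (3 * Cs m) <= 2 * M * (3 * Cs m) by rewrite leq_mul2r ll orbT.
  lia.
by case: li => -> ->; lia.
Qed.

End RoundingStep.

(** * Luby's estimate *)

Definition active_degree (G : graph) (s : {ffun vertex G -> reg}) (v : vertex G) : nat :=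
  \sum_(w | adj v w) active (s w).

Definition active_pairs (G : graph) (s : {ffun vertex G -> reg}) : nat :=
  \sum_v active (s v) * active_degree s v.

Section Luby.

Variables (K : nat) (G : graph) (s : {ffun vertex G -> reg}).

Let a v := active (s v).
Let k v := lev (s v).
Let h v := updeg (s v).

Hypothesis levE : forall v, k v = up_log 2 (active_degree s v).
Hypothesis lev_le : forall v, k v <= K.
Hypothesis updegE : forall v, h v = \sum_(w | adj v w) (a w && (k v <= k w)).

Let L u v := [&& adj u v, a u, a v & k v <= k u].
Let H := \sum_v a v * h v.

Lemma deg_lev v : active_degree s v <= 2 ^ k v.
Proof. by rewrite levE up_logP. Qed.

Lemma sum_above v : \sum_u L u v = a v * h v.
Proof.
rewrite updegE big_distrr [RHS]big_mkcond; apply: eq_bigr => u _ /=.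
rewrite /L adj_sym; case: (adj v u) => //=.
by case: (a u); case: (a v); rewrite ?mul1n.
Qed.

Lemma sum_below u : \sum_v L u v <= 2 ^ k u.
Proof.
apply: leq_trans (deg_lev u); rewrite [leqRHS]big_mkcond; apply: leq_sum => v _.
rewrite /L; case: (adj u v) => //=; rewrite -/(a v).
by case: (a v); case: (a u) => //=; apply: leq_b1.
Qed.

Lemma sum_above_le v : h v <= 2 ^ k v.
Proof.
apply: leq_trans (deg_lev v); rewrite updegE; apply: leq_sum => u _.
by rewrite -/(a u); case: (a u) => //=; apply: leq_b1.
Qed.

Lemma sum_L : \sum_u \sum_v L u v = H.
Proof. by rewrite exchange_big; apply: eq_bigr => v _; apply: sum_above. Qed.

(** Levels are totally ordered, so each active edge points upward in at least one direction. *)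
Lemma pairs_le : active_pairs s <= 2 * H.
Proof.
rewrite mul2n -addnn -{1}sum_L -{1}[H]/(\sum_v a v * h v) -big_split.
apply: leq_sum => v _ /=; rewrite updegE /active_degree !big_distrr.
rewrite [X in X <= _]big_mkcond [X in _ + X]big_mkcond -big_split.
apply: leq_sum => w _; rewrite /L /=; case: (adj v w) => //=.
rewrite -/(a w) -/(a v); case: (a v); case: (a w) => //=.
by case: (leqP (k w) (k v)) => //= /ltnW ->.
Qed.

(** Regrouping by the upper node [u] gives the two quadratic terms of Bonferroni's inequality; the
    symmetrized edge weight yields the factor 2. *)
Lemma pair_costE (X : vertex G -> nat) : pair_cost K s X
  = \sum_u \sum_v \sum_(w | w != v)
      L u v * L u w * 2 ^ (K + k v + k w - k u) * (X v * X w)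
    + 2 * \sum_v \sum_w L w v * (h v * 2 ^ (K + k v)) * (X v * X w).
Proof.
pose E v w := L w v * (h v * 2 ^ (K + k v)) * (X v * X w).
have -> : 2 * \sum_v \sum_w L w v * (h v * 2 ^ (K + k v)) * (X v * X w)
        = \sum_v \sum_(w | w != v) (E v w + E w v).
  have diag v w : ~~ (w != v) -> L w v = false.
    by move=> /negPn /eqP ->; rewrite /L adj_irr.
  have E0 v : \sum_w E v w = \sum_(w | w != v) E v w.
    rewrite [RHS]big_mkcond; apply: eq_bigr => w _.
    by case: ifP => // /negbT /diag; rewrite /E => ->.
  have E1 v : \sum_w E w v = \sum_(w | w != v) E w v.
    rewrite [RHS]big_mkcond; apply: eq_bigr => w _; rewrite eq_sym.
    by case: ifP => // /negbT /diag; rewrite /E => ->.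
  rewrite mul2n -addnn {2}exchange_big -big_split; apply: eq_bigr => v _ /=.
  by rewrite -/(E v) E0 E1 -big_split.
rewrite /pair_cost [X in _ = X + _]exchange_big -big_split; apply: eq_bigr => v _ /=.
rewrite [X in _ = X + _](exchange_big_dep (fun w => w != v)) //= -big_split.
apply: eq_bigr => w wv /=.
rewrite /wt mulnDl mulnDr; congr (_ + _).
  rewrite big_distrl big_distrr big_mkcond [RHS]big_mkcond wv; apply: eq_bigr => u _ /=.
  rewrite /path_weight /L (adj_sym v u) -/(a v) -/(a u) -/(a w) -/(k u) -/(k v) -/(k w).
  case: (adj u v) => //=; case: (adj u w) => //=; rewrite ?muln0 //.
  case: (a u) => /=; last by rewrite !andbF ?muln0.
  case: (a v) => //=; rewrite ?muln0 //; case: (a w) => /=; rewrite ?andbF ?muln0 //.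
  by case: (k v <= k u); case: (k w <= k u); rewrite /= ?muln0 //; lia.
rewrite /edge_weight /E /L (adj_sym w v) -/(a v) -/(a w) -/(k v) -/(k w) -/(h v) -/(h w).
case: (adj v w) => //=; rewrite ?muln0 //.
by case: (a v); case: (a w) => //=; rewrite ?muln0 // !mul1n; lia.
Qed.

(** The levels cancel: each path term below [u] is at most [2 ^ (3 * K - k u)], and at most
    [2 ^ k u] partners are available. An edge term uses [h v <= 2 ^ k v] in the same way and counts
    twice, hence [3 = 1 + 2]. *)
Lemma start_cost :
  pair_cost K s (fun v => a v * 2 ^ (K - k v)) <= 3 * 2 ^ (3 * K) * H.
Proof.
have -> : 3 * 2 ^ (3 * K) * H = 2 ^ (3 * K) * H + 2 * (2 ^ (3 * K) * H) by lia.
rewrite pair_costE; apply: leq_add.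
  rewrite -{1}sum_L big_distrr; apply: leq_sum => u _ /=.
  apply: (@leq_trans (\sum_v \sum_w L u v * L u w * 2 ^ (3 * K - k u))).
    apply: leq_sum => v _; rewrite [leqRHS](bigID (fun w => w != v)) /=.
    apply: leq_trans (leq_addr _ _); apply: leq_sum => w _.
    rewrite -[X in X <= _]mulnA leq_mul2l; apply/orP; right.
    apply: (@leq_trans (2 ^ (K + k v + k w - k u) * (2 ^ (K - k v) * 2 ^ (K - k w)))).
      apply: leq_mul => //.
      by apply: leq_mul; [case: (a v) | case: (a w)]; rewrite ?mul1n.
    rewrite -!expnD leq_exp2l //.
    have := lev_le v; have := lev_le w; have := lev_le u; lia.
  have -> : \sum_v \sum_w L u v * L u w * 2 ^ (3 * K - k u)
          = (\sum_v L u v) * ((\sum_w L u w) * 2 ^ (3 * K - k u)).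
    rewrite big_distrl; apply: eq_bigr => v _ /=; rewrite big_distrl big_distrr.
    by apply: eq_bigr => w _ /=; rewrite mulnA.
  rewrite mulnC leq_mul2r; apply/orP; right.
  apply: leq_trans (leq_mul (sum_below u) (leqnn _)) _.
  by rewrite -expnD leq_exp2l //; have := lev_le u; lia.
rewrite leq_mul2l /= big_distrr; apply: leq_sum => v _ /=.
rewrite -sum_above.
apply: (@leq_trans (\sum_u L u v * 2 ^ (3 * K))); last by rewrite [leqRHS]mulnC big_distrl.
apply: leq_sum => u _; rewrite -mulnA; case Luv: (L u v) => //; rewrite !mul1n.
apply: (@leq_trans (2 ^ k v * 2 ^ (K + k v) * (2 ^ (K - k v) * 2 ^ (K - k u)))).
  apply: leq_mul; first by rewrite leq_mul2r sum_above_le orbT.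
  by apply: leq_mul; [case: (a v) | case: (a u)]; rewrite ?mul1n.
rewrite -!expnD leq_exp2l //.
case/and4P: Luv => _ _ _; have := lev_le v; have := lev_le u; lia.
Qed.

Variable y : vertex G -> bool.
Hypothesis y_active : forall v, y v -> a v.

Definition wins (v : vertex G) : bool :=
  y v && [forall w, adj v w && y w ==> (k w < k v)].

Definition dominated (u : vertex G) : bool := a u && [exists v, adj u v && wins v].

Lemma y_le_wins v : y v <= wins v + y v * \sum_w L w v * y w.
Proof.
rewrite /wins; case yv: (y v) => //=; case: forallP => //= nw; rewrite mul1n.
have [w] : exists w, adj v w && y w && (k v <= k w).
  apply/existsP; apply: contraT; rewrite negb_exists => /forallP nx; case: nw => w.
  by apply/implyP=> vw; move: (nx w); rewrite vw /= -ltnNge.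
case/andP=> /andP[vw yw] le; rewrite (bigD1 w) //= yw /L adj_sym vw.
by rewrite (y_active yv) (y_active yw) le.
Qed.

(* Bonferroni's inequality for the winners below [u], each kept with
   probability [2 ^ k v / 2 ^ k u]; the constant 3 pays for the terms [v = w]
   missing from the square. *)
Lemma bonferroni u :
  2 * \sum_v L u v * (2 ^ (K + k v) * y v)
  <= 3 * (2 ^ (K + k u) * dominated u)
     + \sum_v \sum_(w | w != v) L u v * L u w * 2 ^ (K + k v + k w - k u) * (y v * y w)
     + 2 * \sum_v L u v * \sum_w L w v * (2 ^ (K + k v) * (y v * y w)).
Proof.
pose J v := L u v && wins v.
pose beta := \sum_v J v * 2 ^ k v.
have split1 : \sum_v L u v * (2 ^ (K + k v) * y v)
   <= 2 ^ K * beta + \sum_v L u v * \sum_w L w v * (2 ^ (K + k v) * (y v * y w)).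
  rewrite /beta big_distrr -big_split; apply: leq_sum => v _ /=.
  rewrite /J; case: (L u v); rewrite ?mul1n //=.
  have -> : \sum_w L w v * (2 ^ (K + k v) * (y v * y w))
          = 2 ^ (K + k v) * (y v * \sum_w L w v * y w).
    by rewrite !big_distrr; apply: eq_bigr => w _ /=; lia.
  have -> : 2 ^ K * (wins v * 2 ^ k v) = 2 ^ (K + k v) * wins v by rewrite expnD; lia.
  by rewrite -mulnDr leq_mul2l y_le_wins orbT.
set P := \sum_v \sum_(w | w != v) _.
have J1 v w : J v -> J w -> L u v * L u w * 2 ^ (K + k v + k w - k u) * (y v * y w)
     = 2 ^ (K - k u) * (2 ^ k v * 2 ^ k w).
  move=> /andP[-> /andP[-> _]] /andP[-> /andP[-> _]]; rewrite !mul1n muln1 -!expnD.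
  by congr (2 ^ _); have := lev_le u; lia.
have sq : 2 ^ (K - k u) * (beta * beta) <= P + 2 ^ (K - k u) * (2 ^ k u * beta).
  have -> : 2 ^ (K - k u) * (beta * beta)
     = \sum_v \sum_w J v * J w * (2 ^ (K - k u) * (2 ^ k v * 2 ^ k w)).
    rewrite {1}/beta big_distrl big_distrr; apply: eq_bigr => v _ /=.
    rewrite /beta !big_distrr; apply: eq_bigr => w _ /=; lia.
  have -> : 2 ^ (K - k u) * (2 ^ k u * beta)
     = \sum_v J v * (2 ^ (K - k u) * (2 ^ k v * 2 ^ k u)).
    by rewrite /beta !big_distrr; apply: eq_bigr => v _ /=; lia.
  rewrite -big_split; apply: leq_sum => v _; rewrite (bigD1 v) //= addnC.
  apply: leq_add.
    apply: leq_sum => w _; case Jv: (J v) => //; case Jw: (J w) => //.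
    by rewrite J1 // !mul1n.
  case Jv: (J v) => //; rewrite !mul1n !leq_mul2l leq_exp2l //.
  by case/andP: Jv => /and4P[_ _ _ ->] _; rewrite !orbT.
suff main : 2 * (2 ^ K * beta) <= 3 * (2 ^ (K + k u) * dominated u) + P.
  by move: split1 main; lia.
case nd: (dominated u); last first.
  rewrite /beta big1 ?muln0 // => v _; case Jv: (J v) => //.
  case/andP: Jv => /and4P[uv au _ _] wv; case/negP: nd; rewrite /dominated au.
  by apply/existsP; exists v; rewrite uv.
have eK : 2 ^ K = 2 ^ (K - k u) * 2 ^ k u by rewrite -expnD subnK.
rewrite expnD muln1 eK; move: sq; move: (2 ^ (K - k u)) (2 ^ k u) => c B sq.
(* This follows from the square of [3 * B - 2 * beta]. One of the three copies of [B * beta] absorbs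
   the diagonal in [sq], leaving the two required. *)
have : c * (3 * (B * beta)) <= c * (3 * (B * B) + beta * beta).
  rewrite leq_mul2l; apply/orP; right.
  by have [+ _] := nat_Cauchy (3 * B) (2 * beta); rewrite -!mulnn; lia.
by move: sq; lia.
Qed.

(** The hypothesis, the initial cost and [bon] give [8 * H <= 48 * S + 6 * H] after scaling, so
    [H <= 24 * S]. Counting edges by [H] and rounding degrees up to powers of two each lose a factor
    2, giving 96. *)
Lemma luby_progress :
  2 * 2 ^ (3 * K + 2) * H + pair_cost K s (fun v => y v * 2 ^ (K + 2))
    <= 2 * \sum_v h v * 2 ^ (2 * K + 2 + k v) * (y v * 2 ^ (K + 2))
       + 2 * pair_cost K s (fun v => a v * 2 ^ (K - k v)) ->
  active_pairs s <= 96 * \sum_u dominated u * active_degree s u.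
Proof.
move=> hyp; pose PC := pair_cost K s (fun v => y v).
have PCE : pair_cost K s (fun v => y v * 2 ^ (K + 2)) = 2 ^ (2 * K + 4) * PC.
  have -> : 2 ^ (2 * K + 4) = 2 ^ (K + 2) * 2 ^ (K + 2) by rewrite -expnD; congr (2 ^ _); lia.
  rewrite /PC /pair_cost big_distrr; apply: eq_bigr => v _; rewrite big_distrr.
  by apply: eq_bigr => w _ /=; lia.
pose S1 := \sum_v h v * (2 ^ (K + k v) * y v).
have S1E : \sum_v h v * 2 ^ (2 * K + 2 + k v) * (y v * 2 ^ (K + 2)) = 2 ^ (2 * K + 4) * S1.
  rewrite /S1 big_distrr; apply: eq_bigr => v _ /=; case: (y v); rewrite ?muln0 //.
  rewrite !muln1 mul1n mulnCA -mulnA -!expnD; congr (_ * 2 ^ _); lia.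
pose S := \sum_u 2 ^ k u * dominated u.
have ha v x : a v * h v * (x * y v) = h v * (x * y v).
  by case yv: (y v); rewrite ?muln0 // (y_active yv) mul1n.
have bon : 2 * S1 <= 3 * (2 ^ K * S) + PC.
  have : 2 * \sum_u \sum_v L u v * (2 ^ (K + k v) * y v) <=
      3 * \sum_u 2 ^ (K + k u) * dominated u
      + \sum_u \sum_v \sum_(w | w != v)
          L u v * L u w * 2 ^ (K + k v + k w - k u) * (y v * y w)
      + 2 * \sum_u \sum_v L u v * \sum_w L w v * (2 ^ (K + k v) * (y v * y w)).
    rewrite ![_ * \sum_u _]big_distrr -!big_split.
    by apply: leq_sum => u _; apply: bonferroni.
  have -> : \sum_u \sum_v L u v * (2 ^ (K + k v) * y v) = S1.
    rewrite exchange_big; apply: eq_bigr => v _; rewrite -ha -sum_above big_distrl.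
    by apply: eq_bigr.
  have -> : \sum_u 2 ^ (K + k u) * dominated u = 2 ^ K * S.
    by rewrite /S big_distrr; apply: eq_bigr => u _ /=; rewrite expnD mulnA.
  have -> : \sum_u \sum_v L u v * \sum_w L w v * (2 ^ (K + k v) * (y v * y w))
      = \sum_v \sum_w L w v * (h v * 2 ^ (K + k v)) * (y v * y w).
    rewrite exchange_big; apply: eq_bigr => v _; rewrite -big_distrl /=.
    rewrite sum_above big_distrr; apply: eq_bigr => w _ /=.
    have := ha v (L w v * (2 ^ (K + k v)) * y w); lia.
  by rewrite /PC pair_costE addnA.
have SE : S <= 2 * \sum_u dominated u * active_degree s u.
  rewrite big_distrr; apply: leq_sum => u _ /=.
  case du: (dominated u); rewrite ?muln0 // muln1 mul1n levE.
  have d1 : 0 < active_degree s u.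
    case/andP: du => _ /existsP[v /andP[uv /andP[yv _]]].
    by rewrite /active_degree (bigD1 v) //= -/(a v) (y_active yv).
  move: d1; case: (active_degree s u) => [|[|n]] // _.
  have := @up_log_gtn 2 n.+2 isT isT; have := up_log_gt0 2 n.+2.
  by case: up_log => // e _ /= /ltnW le; rewrite expnS leq_mul2l le.
have HS : H <= 24 * S.
  have := start_cost; move: hyp; rewrite PCE S1E.
  have -> : 2 ^ (3 * K + 2) = 4 * 2 ^ (3 * K) by rewrite expnD mulnC.
  have e4 : 2 ^ (2 * K + 4) * 2 ^ K = 16 * 2 ^ (3 * K).
    by rewrite -expnD (_ : 2 * K + 4 + K = 4 + 3 * K) ?expnD //; lia.
  have p0 : 0 < 2 ^ (3 * K) by rewrite expn_gt0.
  have := leq_mul (leqnn (2 ^ (2 * K + 4))) bon.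
  rewrite mulnDr [2 ^ (2 * K + 4) * (3 * _)]mulnCA (mulnA _ (2 ^ K)) e4.
  move=> b1 b2 b3; rewrite -(leq_pmul2l p0).
  by move: b1 b2 b3; lia.
by have := pairs_le; lia.
Qed.

End Luby.

(** * One phase *)

(** The minimum keeps the register bounded for arbitrary received sums; under the degree bound it
    equals the rounded logarithm. *)
Definition level_instr (K : nat) : instr :=
  Instr (fun _ _ _ _ => 0) (fun _ _ y => active y)
    (fun x c _ => set_lev x (minn K (up_log 2 c))).

Definition updeg_instr (K : nat) : instr :=
  Instr (fun _ _ _ _ => 0) (fun _ x y => active y && (lev x <= lev y))
    (fun x c _ => let: Reg a j l _ _ b h p t := x in
       Reg a j l (minn (2 ^ K) c) (a * 2 ^ (K - l)) b h p t).

(** Mass [2 ^ (K + 2)] is probability 1, that is, a mark; [c] counts the marked neighbors at or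
    above the level of the node. *)
Definition join_instr (K : nat) : instr :=
  Instr (fun _ _ _ _ => 0) (fun _ x y => (mass y == 2 ^ (K + 2)) && (lev x <= lev y))
    (fun x c _ => let: Reg a j l u m b h p t := x in
       Reg a (j || [&& a, m == 2 ^ (K + 2) & c == 0]) l u m b h p t).

Definition retire_instr : instr :=
  Instr (fun _ _ _ _ => 0) (fun _ _ y => joined y)
    (fun x c _ => let: Reg a j l u m b h p t := x in
       Reg [&& a, ~~ j & c == 0] j l u m b h p t).

Definition phase (K : nat) : seq instr :=
  [:: level_instr K; updeg_instr K] ++ loop (rounding_step K) (K + 2)
  ++ [:: join_instr K; retire_instr].

Definition near (G : graph) (v w : vertex G) : bool :=
  (w != v) && (adj v w || [exists u, adj v u && adj u w]).

Record phase_inv (K : nat) (G : graph) (s : {ffun vertex G -> reg}) : Prop := PhaseInv {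
  inv_pre : forall v, pre (s v) = 0;
  inv_base : forall v, base (s v) < 2 ^ (2 * base_bits K);
  inv_proper : forall v w, near v w -> base (s v) != base (s w);
  inv_joined : forall v w, joined (s v) -> joined (s w) -> ~~ adj v w;
  inv_active : forall v, active (s v) ->
    ~~ joined (s v) /\ forall w, adj v w -> ~~ joined (s w);
  inv_retired : forall v, ~~ active (s v) ->
    joined (s v) \/ exists2 w, adj v w & joined (s w) }.

Lemma wt_near K (G : graph) (s : {ffun vertex G -> reg}) v w :
  w != v -> 0 < wt K s v w -> near v w.
Proof.
move=> wv; apply: contraTT; rewrite /near wv negb_or => /andP[/negbTE nvw].
rewrite negb_exists => /forallP nu; rewrite /wt nvw addn0 big1 // => u uw.
by move: (nu u); rewrite uw.
Qed.

Lemma gather_hop1 (G : graph) (s : {ffun vertex G -> reg}) f nxt b v :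
  gather s (Instr (fun _ _ _ _ => 0) f nxt) b v = \sum_(u | adj v u) f b (s v) (s u).
Proof. by apply: eq_bigr => u _ /=; rewrite big1 ?addn0. Qed.

Section Phase.

Variables (K : nat) (G : graph) (s : {ffun vertex G -> reg}).
Hypothesis deg_le : forall v : vertex G, degree v <= 2 ^ K.
Hypothesis inv : phase_inv K s.

Let M := K + 2.
Let a v := active (s v).
Let k v := up_log 2 (active_degree s v).
Let h v := \sum_(w | adj v w) (a w && (k v <= k w)).

Lemma active_degree_le v : active_degree s v <= 2 ^ K.
Proof.
apply: leq_trans (deg_le v); rewrite /degree cardsE -sum1_card.
by apply: leq_sum => w _; apply: leq_b1.
Qed.

Lemma phase_start : exists s2 : {ffun vertex G -> reg},
  exec s [:: level_instr K; updeg_instr K] = s2 /\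
  forall v, [/\ stat (s2 v) = (a v, joined (s v), k v, h v, base (s v)),
                mass (s2 v) = a v * 2 ^ (K - k v) & pre (s2 v) = 0].
Proof.
pose s1 : {ffun vertex G -> reg} := [ffun v => set_lev (s v) (k v)].
have e1 : step s (level_instr K) = s1.
  apply/ffunP=> v; rewrite /step !ffunE gather_hop1 /=.
  congr set_lev; apply/minn_idPr; apply: up_log_min => //.
  exact: active_degree_le.
have a1 v : active (s1 v) = a v by rewrite ffunE /a; case: (s v).
have l1 v : lev (s1 v) = k v by rewrite ffunE; case: (s v).
exists (step s1 (updeg_instr K)); split=> [|v]; first by rewrite /= e1.
have hE : gather s1 (updeg_instr K) false v = h v.
  by rewrite gather_hop1; apply: eq_bigr => w _; rewrite a1 !l1.
have hle : h v <= 2 ^ K.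
  apply: leq_trans (active_degree_le v); apply: leq_sum => w _.
  by rewrite -/(a w); case: (a w) => //=; apply: leq_b1.
have p0 := inv_pre inv v.
rewrite /step ffunE hE /= (minn_idPr hle) ffunE /stat /a.
by move: p0; case: (s v).
Qed.

(** After [i] steps every nonzero mass is a power of two with exponent between [i] and [M], so after
    [M] steps it is [2 ^ M]. Meanwhile the quadratic weight falls from [2 * M] to [M], and the
    factor [M] cancels. *)
Lemma phase_rounding (s2 : {ffun vertex G -> reg}) :
  (forall v, [/\ stat (s2 v) = (a v, joined (s v), k v, h v, base (s v)),
                 mass (s2 v) = a v * 2 ^ (K - k v) & pre (s2 v) = 0]) ->
  let s3 := exec s2 (loop (rounding_step K) M) in
  [/\ forall v, stat (s3 v) = stat (s2 v), forall v, pre (s3 v) = 0,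
      forall v, (mass (s3 v) == 0) || a v && (mass (s3 v) == 2 ^ M) &
      2 * 2 ^ (3 * K + 2) * (\sum_v a v * h v)
        + pair_cost K s2 (fun v => mass (s3 v))
      <= 2 * \sum_v h v * 2 ^ (2 * K + 2 + k v) * mass (s3 v)
        + 2 * pair_cost K s2 (fun v => a v * 2 ^ (K - k v))].
Proof.
move=> s2E.
have kK v : k v <= K by apply: up_log_min => //; apply: active_degree_le.
pose m2 v := a v * 2 ^ (K - k v).
pose A v := M * (h v * 2 ^ (2 * K + 2 + k v)).
pose Inv i (s' : {ffun vertex G -> reg}) :=
  [/\ forall v, stat (s' v) = stat (s2 v), forall v, pre (s' v) = 0,
      forall v, mass (s' v) = 0 \/ a v /\ exists2 j, i <= j <= M & mass (s' v) = 2 ^ j &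
      2 * (\sum_v A v * m2 v) + (2 * M - i) * pair_cost K s2 (fun v => mass (s' v))
      <= 2 * (\sum_v A v * mass (s' v)) + 2 * M * pair_cost K s2 m2].
have cE (X : vertex G -> nat) (s' : {ffun vertex G -> reg}) :
    (forall v, stat (s' v) = stat (s2 v)) -> pair_cost K s' X = pair_cost K s2 X.
  by move=> e; apply: eq_bigr => v _; apply: eq_bigr => w _; rewrite (wt_stat K e).
have : Inv M (exec s2 (loop (rounding_step K) M)).
  apply: exec_loop => [|i s' li [st' p' m' pot]].
    split=> // [v|v|]; first by case: (s2E v).
      case: (s2E v) => _ -> _; case: (a v); last by left.
      right; split=> //; exists (K - k v); rewrite ?mul1n //.
      by rewrite /M; apply: leq_trans (leq_subr _ _) (leq_addr _ _).
    have e v : mass (s2 v) = m2 v by case: (s2E v).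
    rewrite subn0 leq_eqVlt; apply/orP; left; apply/eqP; congr (_ + _).
      by congr (_ * _); apply: eq_bigr => v _; rewrite e.
    by congr (_ * _); apply: eq_bigr => v _; apply: eq_bigr => w _; rewrite !e.
  have bE v : base (s' v) = base (s v).
    by case: (s2E v) => e _ _; move: (st' v); rewrite e => -[].
  have lt' v : base (s' v) < 2 ^ (2 * base_bits K) by rewrite bE; apply: inv_base inv v.
  have pr' v w : w != v -> 0 < wt K s' v w -> base (s' v) != base (s' w).
    by move=> wv /(wt_near wv); rewrite !bE; apply: inv_proper inv v w.
  have [st p m pot'] := rounding_step_ok i p' lt' pr'.
  set s'' := exec s' _ in st p m pot' *.
  have st'' v : stat (s'' v) = stat (s2 v) by rewrite st st'.
  split=> // [v|].
    move: (m v); case: (m' v) => [->|[av [j /andP[ij jM] ->]]].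
      by rewrite [0 == _]eq_sym expn_eq0 /= => /eqP ->; left.
    rewrite eqn_exp2l //; have [_|ne] := eqVneq j i.
      case/orP=> /eqP ->; [by left|right; split=> //; exists i.+1 => //].
      by rewrite leqnn.
    move=> /eqP ->; right; split=> //; exists j => //.
    by rewrite jM andbT ltn_neqAle eq_sym ne.
  move: pot'; rewrite !cE //.
  have AE X : \sum_v (K + 2) * (updeg (s' v) * 2 ^ (2 * K + 2 + lev (s' v))) * X v
            = \sum_v A v * X v.
    apply: eq_bigr => v _; case: (s2E v) => e _ _; move: (st' v); rewrite e.
    by case=> _ _ -> -> _.
  rewrite !AE -/M; move: pot; move: ((2 * M - i) * _) ((2 * M - i.+1) * _) => x y; lia.
move=> [st3 p3 m3 pot] s3; split=> // [v|].
  case: (m3 v) => [->|[av [j ij ->]]] //.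
  by rewrite -eqn_leq in ij; rewrite av -(eqP ij) eqxx orbT.
have AE X : \sum_v A v * X v = M * \sum_v h v * 2 ^ (2 * K + 2 + k v) * X v.
  by rewrite big_distrr; apply: eq_bigr => v _ /=; rewrite /A -!mulnA.
have HE : \sum_v h v * 2 ^ (2 * K + 2 + k v) * m2 v = 2 ^ (3 * K + 2) * \sum_v a v * h v.
  rewrite big_distrr; apply: eq_bigr => v _; rewrite /m2 /=.
  case: (a v); rewrite ?muln0 // !mul1n -mulnA -expnD mulnC; congr (2 ^ _ * _).
  by have := kK v; lia.
move: pot; rewrite !AE HE (_ : 2 * M - M = M); last by lia.
have M0 : 0 < M by rewrite /M addn2.
have cancel p x c z c' : 2 * (M * (p * x)) + M * c <= 2 * (M * z) + 2 * M * c' ->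
    2 * p * x + c <= 2 * z + 2 * c'.
  by move=> le; rewrite -(leq_pmul2l M0); move: M le => n; lia.
exact: cancel.
Qed.

(** Dominated nodes retire, and their degrees alone account for a [1 / 96] share of the active
    pairs. *)
Lemma phase_ok : let s' := exec s (phase K) in
  phase_inv K s' /\ 96 * active_pairs s' <= 95 * active_pairs s.
Proof.
rewrite /phase !exec_cat; have [s2 [-> s2E]] := phase_start.
have [st3 p3 m3 pot] := phase_rounding s2E.
set s3 := exec s2 _ in st3 p3 m3 pot *.
pose y v := mass (s3 v) == 2 ^ M.
have y_act v : y v -> a v.
  by rewrite /y; case/orP: (m3 v) => [/eqP -> |/andP[] //]; rewrite eq_sym expn_eq0.
have act2 v : active (s2 v) = a v by case: (s2E v) => -[].
have lev2 v : lev (s2 v) = k v by case: (s2E v) => -[].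
have deg2 v : active_degree s2 v = active_degree s v.
  by apply: eq_bigr => w _; rewrite act2.
have levE v : lev (s2 v) = up_log 2 (active_degree s2 v) by rewrite lev2 deg2.
have lev_le v : lev (s2 v) <= K.
  by rewrite lev2; apply: up_log_min => //; apply: active_degree_le.
have updegE v : updeg (s2 v)
    = \sum_(w | adj v w) (active (s2 w) && (lev (s2 v) <= lev (s2 w))).
  by case: (s2E v) => -[_ _ _ -> _] _ _; apply: eq_bigr => w _; rewrite act2 !lev2.
have y_act2 v : y v -> active (s2 v) by rewrite act2; apply: y_act.
pose wn := wins s2 y; pose dm := dominated s2 y.
have progress : active_pairs s <= 96 * \sum_u dm u * active_degree s u.
  have -> : active_pairs s = active_pairs s2.
    by apply: eq_bigr => v _; rewrite act2 deg2.
  rewrite (_ : \sum_u _ = \sum_u dm u * active_degree s2 u); last first.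
    by apply: eq_bigr => u _; rewrite deg2.
  apply: (luby_progress levE lev_le updegE y_act2); rewrite -/M.
  have my v : mass (s3 v) = y v * 2 ^ M.
    by rewrite /y; case/orP: (m3 v) => [|/andP[_]] /eqP ->;
      rewrite ?eqxx ?mul1n // eq_sym expn_eq0.
  have e1 : \sum_v active (s2 v) * updeg (s2 v) = \sum_v a v * h v.
    by apply: eq_bigr => v _; case: (s2E v) => -[-> _ _ -> _].
  have e2 : pair_cost K s2 (fun v => y v * 2 ^ M) = pair_cost K s2 (fun v => mass (s3 v)).
    by apply: eq_bigr => v _; apply: eq_bigr => w _; rewrite !my.
  have e3 : \sum_v updeg (s2 v) * 2 ^ (2 * K + 2 + lev (s2 v)) * (y v * 2 ^ M)
          = \sum_v h v * 2 ^ (2 * K + 2 + k v) * mass (s3 v).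
    by apply: eq_bigr => v _; rewrite my lev2; case: (s2E v) => -[_ _ _ -> _].
  have e4 : pair_cost K s2 (fun v => active (s2 v) * 2 ^ (K - lev (s2 v)))
          = pair_cost K s2 (fun v => a v * 2 ^ (K - k v)).
    by apply: eq_bigr => v _; apply: eq_bigr => w _; rewrite !act2 !lev2.
  by rewrite e1 e2 e3 e4.
have st v : [/\ active (s3 v) = a v, joined (s3 v) = joined (s v), lev (s3 v) = k v
    & base (s3 v) = base (s v)].
  by case: (s2E v) => e _ _; move: (st3 v); rewrite e => -[-> -> -> _ ->].
set s4 := step s3 (join_instr K).
have s4E v : [/\ active (s4 v) = a v, joined (s4 v) = joined (s v) || wn v,
    base (s4 v) = base (s v) & pre (s4 v) = 0].
  have [a3 j3 l3 b3] := st v.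
  have -> : wn v = [&& active (s3 v), mass (s3 v) == 2 ^ M
                    & gather s3 (join_instr K) false v == 0].
    rewrite a3 gather_hop1 sum_nat_eq0 /wn /wins -/(y v).
    case yv: (y v); last by rewrite andbF.
    rewrite (y_act v yv) /=; apply: eq_forallb => w.
    have [_ _ -> _] := st w; rewrite l3 !lev2 -/(y w) eqb0.
    by case: (adj v w) => //=; case: (y w) => //=; rewrite ltnNge.
  rewrite -j3 -b3 -a3 /s4 /step ffunE; move: (p3 v).
  by case: (s3 v).
rewrite /exec /= -/s4; set s5 := step s4 retire_instr.
pose j' v := joined (s v) || wn v.
have s5E v : [/\ active (s5 v) = [&& a v, ~~ j' v & [forall w, adj v w ==> ~~ j' w]],
    joined (s5 v) = j' v, base (s5 v) = base (s v) & pre (s5 v) = 0].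
  have [a4 j4 <- p4] := s4E v.
  have -> : [forall w, adj v w ==> ~~ j' w] = (gather s4 retire_instr false v == 0).
    rewrite gather_hop1 sum_nat_eq0; apply: eq_forallb => w.
    by have [_ -> _ _] := s4E w; rewrite eqb0.
  by rewrite /j' -a4 -j4 /s5 /step ffunE; move: p4; case: (s4 v).
have wn_act v : wn v -> a v by case/andP=> /y_act.
split.
  split=> [v|v|v w|v w|v|v].
  - by case: (s5E v).
  - by case: (s5E v) => _ _ -> _; apply: inv_base inv v.
  - by case: (s5E v) => _ _ -> _; case: (s5E w) => _ _ -> _; apply: inv_proper inv v w.
  - case: (s5E v) => _ -> _ _; case: (s5E w) => _ -> _ _.
    (* Winners were active, so none of their neighbors had joined earlier. Two adjacent winners
       would each have the strictly higher level. *)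
    have free x z : joined (s x) -> wn z -> ~~ adj z x.
      move=> jx /wn_act az; apply: contraL jx => zx.
      by have [_ ] := inv_active inv az; apply.
    case/orP=> jv /orP[] jw; first exact: inv_joined inv v w jv jw.
    + by rewrite adj_sym; apply: free jv jw.
    + by apply: free jw jv.
    case/andP: jv => yv /forallP nv; case/andP: jw => yw /forallP nw.
    apply/negP=> vw; move: (nv w) (nw v); rewrite vw adj_sym vw yv yw /= => l1 l2.
    by move: (ltn_trans l1 l2); rewrite ltnn.
  - case: (s5E v) => -> -> _ _ /and3P[_ jv /forallP nv]; split=> // w vw.
    by case: (s5E w) => _ -> _ _; move: (nv w); rewrite vw.
  - case: (s5E v) => -> -> _ _; rewrite !negb_and => /or3P[nv|jv|].
    + case: (inv_retired inv nv) => [jv|[w vw jw]]; first by left; rewrite /j' jv.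
      by right; exists w => //; case: (s5E w) => _ -> _ _; rewrite /j' jw.
    + by left; apply: contraNT jv => ->.
    rewrite negb_forall => /existsP[w]; rewrite negb_imply negbK => /andP[vw jw].
    by right; exists w => //; case: (s5E w) => _ -> _ _.
have drop : active_pairs s5 + \sum_u dm u * active_degree s u <= active_pairs s.
  rewrite -big_split; apply: leq_sum => u _ /=.
  have [-> _ _ _] := s5E u; case du: (dm u).
    have [au [v uv wv]] : a u /\ exists2 v, adj u v & wn v.
      case/andP: du; rewrite act2 => au /existsP[v /andP[uv wv]].
      by split=> //; exists v.
    have -> : [forall w, adj u w ==> ~~ j' w] = false.
      by apply/forallP=> /(_ v); rewrite uv /j' wv orbT.
    by rewrite !andbF -/(a u) au.
  rewrite addn0 leq_mul //; first by rewrite -/(a u); case: (a u) => //; apply: leq_b1.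
  apply: leq_sum => w _; have [-> _ _ _] := s5E w.
  by rewrite -/(a w); case: (a w) => //; apply: leq_b1.
by move: progress drop; lia.
Qed.

End Phase.

(** * Initial distance-two coloring *)

(** One bit of color length gained per pass is enough: [I] passes of [O(K)] instructions stay within
    the round bound. *)
Definition setup (K I : nat) : seq instr :=
  loop (fun _ => search K (base_bits K) 3 ++ [:: rebase_instr (base_bits K) 3]) I.

(** With level 0 and unit [updeg] and [mass], every pair at distance one or two has positive weight,
    so zero clash cost means a proper distance-two recoloring. *)
Definition start (x : nat) : reg := Reg true false 0 1 1 x 0 0 0.

Section Setup.

Variables (K I : nat) (G : network).
Hypotheses (K0 : 0 < K) (deg_le : forall v : vertex G, degree v <= 2 ^ K).
Hypothesis ident_lt : forall v : vertex G, ident v < 2 ^ I.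

(** There are at most [2 ^ (2 * K)] paths of weight [2 ^ K] and [2 ^ K] edges of weight
    [2 * 2 ^ K]. *)
Lemma start_total (c : vertex G -> nat) v :
  \sum_(w | w != v) wt K [ffun x => start (c x)] v w * mass ([ffun x => start (c x)] w)
  <= 2 * 2 ^ (3 * K).
Proof.
have deg_sum (x : vertex G) : \sum_(w | adj x w) 1 <= 2 ^ K.
  by rewrite sum1_card -cardsE; apply: deg_le.
have K2 : 2 * 2 ^ K <= 2 ^ K * 2 ^ K.
  by rewrite leq_mul2r -{2}(prednK K0) expnS leq_pmulr ?expn_gt0 // orbT.
have -> : 2 ^ (3 * K) = 2 ^ K * (2 ^ K * 2 ^ K) by rewrite -!expnD; congr (2 ^ _); lia.
apply: (@leq_trans (\sum_w \sum_(u | adj v u && adj u w) 2 ^ K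
                    + \sum_(w | adj v w) 2 * 2 ^ K)); last first.
  have -> : \sum_w \sum_(u | adj v u && adj u w) 2 ^ K
     = \sum_(u | adj v u) 2 ^ K * \sum_(w | adj u w) 1.
    rewrite (exchange_big_dep (fun u => adj v u)) /=; last by move=> w u _ /andP[].
    apply: eq_bigr => u uv; rewrite big_distrr /= muln1; apply: eq_bigl => w.
    by rewrite uv.
  have h1 : \sum_(u | adj v u) 2 ^ K * \sum_(w | adj u w) 1 <= 2 ^ K * (2 ^ K * 2 ^ K).
    apply: (@leq_trans (\sum_(u | adj v u) 2 ^ K * 2 ^ K)).
      by apply: leq_sum => u _; rewrite leq_mul2l deg_sum orbT.
    rewrite -[X in \sum_(u | _) X]mul1n -big_distrl /= leq_mul2r deg_sum orbT //.
  have h2 : \sum_(w | adj v w) 2 * 2 ^ K <= 2 ^ K * (2 ^ K * 2 ^ K).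
    rewrite -[X in \sum_(w | _) X]mul1n -big_distrl /=.
    by apply: leq_mul => //; apply: deg_sum.
  lia.
rewrite [X in _ + X]big_mkcond -big_split big_mkcond; apply: leq_sum => w _ /=.
case: ifP => // _; rewrite !ffunE muln1 /wt leq_add //.
  by apply: leq_sum => u _; rewrite !ffunE /path_weight /= mul1n; rewrite !addn0 subn0.
rewrite !ffunE /edge_weight /=; case: (adj v w) => //; rewrite !mul1n addn0; lia.
Qed.

(** The clash cost at the chosen point is at most [6 * 2 ^ (3 * K) / 2 ^ (3 * K + 3)], below 1 and
    integral, hence zero: each pass preserves properness. *)
Lemma setup_ok : exists c : vertex G -> nat,
  [/\ exec [ffun v : vertex G => start (ident v)] (setup K I) = [ffun v => start (c v)],
      forall v, c v < 2 ^ (2 * base_bits K) &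
      forall v w, near v w -> c v != c w].
Proof.
set b := base_bits K.
have b0 : 0 < b by rewrite /b /base_bits addn3.
pose Inv i (s' : {ffun vertex G -> reg}) := exists c : vertex G -> nat,
  [/\ s' = [ffun v => start (c v)],
      forall v, c v < 2 ^ (2 * b + (I - i)) & forall v w, near v w -> c v != c w].
suff : Inv I (exec [ffun v : vertex G => start (ident v)] (setup K I)).
  by case=> c []; rewrite subnn addn0; exists c.
apply: exec_loop => [|i s' li [c [-> lc nc]]].
  exists (@ident G); split=> // [v|v w /andP[wv _]].
    by rewrite (leq_trans (ident_lt v)) // leq_exp2l // subn0 leq_addl.
  by apply: contra wv => /eqP/ident_inj ->.
set s := finfun _.
have pre0 v : pre (s v) = 0 by rewrite ffunE.
rewrite exec_cat; have [f [-> Hf]] := search_ok K b0 (isT : 0 < 3) pre0.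
pose c' v := recode b 3 (c v) (f v).
have baseE v : base (s v) = c v by rewrite ffunE.
exists c'; split=> [|v|v w vw].
- apply/ffunP=> v; rewrite /= /step !ffunE /= /c' /start.
  by rewrite modn_small //; case: (Hf v).
- apply: leq_trans (recode_lt b0 (isT : 0 < 3) (lc v) (Hf v).1) _.
  by rewrite leq_exp2l //; lia.
apply/negP=> /eqP e.
have := @recode_clash K b 3 G s b0 isT f v (fun v => (Hf v).1).
rewrite leqNgt => /negP; apply; apply: (@leq_ltn_trans 0).
  rewrite -ltnS -(ltn_pmul2l (expn_gt0 2 b)).
  rewrite muln1; apply: leq_ltn_trans (Hf v).2 _.
  apply: leq_ltn_trans (leq_mul (leqnn 3) (start_total c v)) _.
  have : 0 < 2 ^ (3 * K) by rewrite expn_gt0.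
  by rewrite /b /base_bits expnD; lia.
rewrite (bigD1 w) /=; last by case/andP: vw.
rewrite !baseE (nc _ _ vw) -/(c' v) -/(c' w) e eqxx muln1 ltn_addr //.
rewrite muln_gt0 ffunE andbT /wt.
case/andP: vw => _ /orP[vw|/existsP[u uvw]].
  by rewrite vw !ffunE /edge_weight /= !mul1n; rewrite ltn_addl // addn_gt0 expn_gt0.
by rewrite (bigD1 u) //= !ffunE /path_weight /= mul1n -!addnA ltn_addr // expn_gt0.
Qed.

End Setup.

(** * Message and round bounds *)

(** Once no two active nodes are adjacent, all remaining active nodes can join together. *)
Definition final_instr : instr :=
  Instr (fun _ _ _ _ => 0) (fun _ _ _ => 0)
    (fun x _ _ => let: Reg a j l u m b h p t := x in Reg a (j || a) l u m b h p t).

(** Taking the minimum with [N] keeps messages at [O(log N)] bits even when [D] far exceeds the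
    number of nodes. *)
Definition level_bound (N D : nat) : nat := log2 (minn D N).

Definition program (c N D : nat) : seq instr :=
  setup (level_bound N D) (c * log2 N)
  ++ loop (fun _ => phase (level_bound N D)) (95 * (2 * log2 N).+1)
  ++ [:: final_instr].

Definition color_bits (c N D : nat) : nat :=
  c * log2 N + 2 * base_bits (level_bound N D) + 4 * slot_bits (level_bound N D).

(** Exceeds by one the exponent of a relayed sum: [2 ^ K] terms of size at most
    [2 ^ (4 * K + 2 + w0)], where [w0] is [color_bits]. *)
Definition msg_width (c N D : nat) : nat :=
  5 * level_bound N D + 3 + color_bits c N D.

Lemma every_mkseq (T : Type) (p : T -> Prop) f n :
  (forall i, i < n -> p (f i)) -> every p (mkseq f n).
Proof.
elim: n => // n IH pf; rewrite mkseqS -cats1; apply: every_cat.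
  by apply: IH => i li; apply: pf; apply: ltnW.
by split=> //; apply: pf.
Qed.

Lemma every_loop (p : instr -> Prop) f n :
  (forall i, i < n -> every p (f i)) -> every p (loop f n).
Proof.
rewrite /loop; elim: n => // n IH pf; rewrite mkseqS flatten_rcons; apply: every_cat.
  by apply: IH => i li; apply: pf; apply: ltnW.
exact: pf.
Qed.

Section Bounds.

Variables (K w0 : nat).
Hypotheses (base_w0 : 2 * base_bits K <= w0) (slot_w0 : 4 * slot_bits K <= w0).

Record bounded (r : reg) : Prop := Bounded {
  lev_b : lev r <= K;
  updeg_b : updeg r <= 2 ^ K;
  mass_b : mass r <= 2 ^ (K + 2);
  base_b : base r < 2 ^ w0;
  hue_b : hue r < 2 ^ w0;
  pre_b : pre r < 2 ^ w0;
  slot_b : slot r <= 2 ^ w0 }.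

Let ok (i : instr) : Prop :=
  (forall r x y, bounded r -> bounded (advance i r x y)) /\
  (forall b r r' r'', bounded r -> bounded r' -> bounded r'' ->
     hop2 i b r r' r'' <= 2 ^ (4 * K + 2 + w0)).

Lemma base_bits_gt0 : 0 < base_bits K.
Proof. by rewrite /base_bits addn3. Qed.

Lemma slot_bits_gt0 : 0 < slot_bits K.
Proof. by rewrite /slot_bits up_log_gt0; lia. Qed.

Lemma path_weight_bound r r' r'' : bounded r -> bounded r' -> bounded r'' ->
  path_weight K r r' r'' <= 2 ^ (3 * K).
Proof.
move=> b b' b''; rewrite /path_weight; case: [&& _, _, _, _ & _] => //.
by rewrite mul1n leq_exp2l //; have := lev_b b; have := lev_b b''; lia.
Qed.

Lemma weighted_tame phi nxt :
  (forall r x y, bounded r -> bounded (nxt r x y)) ->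
  (forall b r r', bounded r -> bounded r' -> exists2 x, phi b r r' = mass r' * x & x <= 2 ^ w0) ->
  ok (weighted K phi nxt).
Proof.
move=> Hn Hp; split=> // b r r' r'' br br' br'' /=.
have [x -> lx] := Hp b r r'' br br''.
have -> : 4 * K + 2 + w0 = 3 * K + (K + 2 + w0) by lia.
rewrite expnD leq_mul ?path_weight_bound // expnD leq_mul //.
exact: mass_b.
Qed.

Lemma search_tame r d : r <= w0 -> every ok (search K r d).
Proof.
move=> rw; apply: every_mkseq => i _; apply: weighted_tame => [x c0 c1|b x y bx yb].
  case: x => va vj vl vu vm vb vh vp vt [/= h1 h2 h3 h4 h5 h6 h7]; split=> //=.
  by rewrite (leq_trans (ltn_pmod _ _)) ?expn_gt0 // leq_exp2l.
eexists; first by [].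
apply: (@leq_trans (2 ^ r)); last by rewrite leq_exp2l.
rewrite big_mkcond -[X in _ <= X]card_ord -sum1_card; apply: leq_sum => a _.
by case: ifP => // _; apply: leq_b1.
Qed.

Lemma recode_bound r d c a : 0 < r -> 1 < d -> 2 * r <= w0 -> c < 2 ^ w0 ->
  recode r d c (a %% 2 ^ r) < 2 ^ w0.
Proof.
move=> r0 d1 rw lc.
have la : a %% 2 ^ r < 2 ^ r by rewrite ltn_pmod ?expn_gt0.
apply: leq_trans (recode_lt r0 (ltnW d1) lc la) _.
have : r * 2 <= r * d by rewrite leq_mul2l d1 orbT.
by rewrite leq_exp2l //; lia.
Qed.

Lemma rounding_step_tame i : i < K + 2 -> every ok (rounding_step K i).
Proof.
move=> iK; apply: every_cat; first by apply: search_tame; lia.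
have s0 := slot_bits_gt0; have b0 := base_bits_gt0.
split.
  split=> // x y z; case: x => va vj vl vu vm vb vh vp vt [/= h1 h2 h3 h4 h5 h6 h7].
  split=> //=; last by rewrite expn_gt0.
  by apply: recode_bound => //; lia.
apply: every_cat.
  apply: every_mkseq => t _; apply: weighted_tame => [x c0 c1 bx|b x y _ _].
    case: ifP => // _; case: x bx => va vj vl vu vm vb vh vp vt [/= h1 h2 h3 h4 h5 h6 h7].
    split=> //=; rewrite /guess /=.
    by apply: leq_trans (code_lt _ _ s0 (isT : 0 < 4)) _; rewrite leq_exp2l //; lia.
  by eexists; [by []|apply: leq_trans (leq_b1 _) _; rewrite expn_gt0].
apply: every_mkseq => t _; apply: weighted_tame => [x c0 c1 bx|b x y _ _].
  case: ifP => // _; case: x bx => va vj vl vu vm vb vh vp vt [/= h1 h2 h3 h4 h5 h6 h7].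
  by split=> //=; case: ifP => // _; rewrite leq_exp2l // addn2 in iK *.
by eexists; [by []|apply: leq_trans (leq_b1 _) _; rewrite expn_gt0].
Qed.

Lemma phase_tame : every ok (phase K).
Proof.
split.
  split=> // x y z; case: x => va vj vl vu vm vb vh vp vt [/= h1 h2 h3 h4 h5 h6 h7].
  by split=> //=; rewrite geq_minl.
split.
  split=> // x y z; case: x => va vj vl vu vm vb vh vp vt [/= h1 h2 h3 h4 h5 h6 h7].
  split=> //=; first by rewrite geq_minl.
  by case: va; rewrite ?mul1n // leq_exp2l //; lia.
apply: (@every_cat _ _ (loop _ _)); first by apply: every_loop => i li; apply: rounding_step_tame.
by do 2 (split; first by split=> // -[a j l u m b h p t] x y [*]; split).
Qed.

Lemma setup_tame I : every ok (setup K I).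
Proof.
have b0 := base_bits_gt0.
apply: every_loop => i _; apply: every_cat; first by apply: search_tame; lia.
split=> //; split=> // x y z.
case: x => va vj vl vu vm vb vh vp vt [/= h1 h2 h3 h4 h5 h6 h7].
split=> //=; last by rewrite expn_gt0.
by apply: recode_bound.
Qed.

Lemma final_tame : ok final_instr.
Proof. by split=> // -[a j l u m b h p t] x y [*]; split. Qed.

End Bounds.

(** * Length of the program and growth of powers *)

Lemma size_loop f n m : (forall i, size (f i) <= m) -> size (loop f n) <= n * m.
Proof.
move=> fm; rewrite /loop; elim: n => // n IH.
by rewrite mkseqS flatten_rcons size_cat mulSn addnC leq_add.
Qed.

Lemma slot_bits_le K : slot_bits K <= K + 10.
Proof.
apply: up_log_min => //; have -> : K + 10 = 8 + (K + 2) by lia.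
by rewrite expnD; apply: leq_mul => //; apply/ltnW/ltn_expl.
Qed.

Lemma slot_count_le K : 2 ^ slot_bits K <= 384 * (K + 2).
Proof.
have n1 : 1 < 192 * (K + 2) by lia.
have := up_log_gtn (isT : 1 < 2) n1; have := up_log_gt0 2 (192 * (K + 2)).
rewrite n1 -/(slot_bits K); case: (slot_bits K) => // m _ /= /ltnW le.
rewrite expnS (_ : 384 * _ = 2 * (192 * (K + 2))); last by lia.
by rewrite leq_mul2l le.
Qed.

Lemma size_phase : exists C, forall K, 0 < K -> size (phase K) <= C * K ^ 2.
Proof.
exists (3 * 2400 + 4) => K K0.
have step i : size (rounding_step K i) <= 2400 * K.
  rewrite !size_cat /= size_cat !size_mkseq.
  by have := slot_bits_le K; have := slot_count_le K; lia.
rewrite /phase !size_cat /= -mulnn.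
have := size_loop (K + 2) step; set x := size _.
have : K <= K * K by rewrite leq_pmulr.
lia.
Qed.

Lemma size_program c : exists C, forall N D,
  size (program c N D) <= C * (level_bound N D ^ 2 * log2 N).
Proof.
have [C1 HC] := size_phase; exists (7 * c + 285 * C1 + 1) => N D.
set K := level_bound N D; set l := log2 N.
have K0 : 0 < K by rewrite /K /level_bound /log2 leq_max.
have l0 : 0 < l by rewrite /l /log2 leq_max.
rewrite /program -/K -/l; set P1 := setup _ _; set P2 := loop _ _.
rewrite size_cat [size (P2 ++ _)]size_cat (_ : size [:: final_instr] = 1) //.
have s1 : size P1 <= c * l * (7 * K ^ 2).
  apply: size_loop => i; rewrite size_cat size_mkseq /= /base_bits -mulnn; nia.
have s2 : size P2 <= 95 * (2 * l).+1 * (C1 * K ^ 2).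
  by apply: size_loop => i; apply: HC.
have KK : 0 < K ^ 2 by rewrite expn_gt0 K0.
have h : 95 * (2 * l).+1 * (C1 * K ^ 2) <= 285 * l * (C1 * K ^ 2).
  by rewrite leq_mul2r; apply/orP; right; lia.
have p : 0 < K ^ 2 * l by rewrite muln_gt0 KK.
move: s1 (leq_trans s2 h) p; move: (K ^ 2) (size P1) (size P2) => x y z; lia.
Qed.

Lemma expn_succ_ge a n : a ^ n.+1 + n.+1 * a ^ n <= a.+1 ^ n.+1.
Proof.
elim: n => [|n IH]; first by rewrite !expn1 expn0 muln1 addn1.
rewrite [leqRHS]expnS; apply: leq_trans (leq_mul (leqnn _) IH).
rewrite !expnS; lia.
Qed.

(** The first two terms of the binomial expansion give [2 * a ^ a <= a.+1 ^ a], so [a] phases with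
    ratio [a / a.+1] halve the active pairs. *)
Lemma expn_half a q : 0 < a -> 2 ^ q * a ^ (a * q) <= a.+1 ^ (a * q).
Proof.
move=> /prednK <-; case: q => [|q]; first by rewrite muln0.
rewrite !expnM -expnMn leq_exp2r //; apply: leq_trans (expn_succ_ge _ _).
by rewrite expnS; lia.
Qed.

(** * The algorithm *)

(** The base is a variable tied to 95 by an equation, which keeps the numeral opaque inside
    powers. *)
Lemma phases_ok (K : nat) (G : graph) (s : {ffun vertex G -> reg}) (a n : nat) :
  a = 95 -> (forall v : vertex G, degree v <= 2 ^ K) -> phase_inv K s ->
  let s' := exec s (loop (fun _ => phase K) n) in
  phase_inv K s' /\ a.+1 ^ n * active_pairs s' <= a ^ n * active_pairs s.
Proof.
move=> ea deg_le inv.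
apply: (exec_loop (Inv := fun i s' => phase_inv K s' /\
  a.+1 ^ i * active_pairs s' <= a ^ i * active_pairs s)) => [|i s' _ [inv' le]].
  by rewrite !expn0.
have [inv'' le'] := phase_ok deg_le inv'; split=> //.
rewrite !expnSr -!mulnA; apply: leq_trans (_ : a.+1 ^ i * (a * active_pairs s') <= _).
  by rewrite leq_mul2l ea le' orbT.
by rewrite mulnCA [_ ^ i * (a * _)]mulnCA leq_mul2l le orbT.
Qed.

Lemma active_pairs_le (G : graph) (s : {ffun vertex G -> reg}) :
  active_pairs s <= #|vertex G| ^ 2.
Proof.
rewrite -mulnn; apply: (@leq_trans (\sum_(v : vertex G) #|vertex G|)); last first.
  by rewrite sum_nat_const.
apply: leq_sum => v _; rewrite -[leqRHS]mul1n leq_mul ?leq_b1 // -sum1_card.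
rewrite /active_degree [leqLHS]big_mkcond; apply: leq_sum => w _.
by case: ifP => // _; apply: leq_b1.
Qed.

Section Main.

Variables (c n N D : nat) (G : network).
Hypothesis adm : admissible c n N D G.

Let K := level_bound N D.
Let s0 : {ffun vertex G -> reg} := [ffun v => start (ident v)].

Lemma level_bound_gt0 : 0 < K.
Proof. by rewrite /K /level_bound /log2 leq_max. Qed.

Lemma leq_exp_log2 x : x <= 2 ^ log2 x.
Proof. by apply: leq_trans (@up_logP 2 x isT) _; rewrite leq_exp2l // leq_maxr. Qed.

Lemma leq_log2 x y : x <= y -> log2 x <= log2 y.
Proof. by move=> xy; rewrite /log2 geq_max !leq_max leq_up_log ?orbT. Qed.

Lemma log2_gt0 x : 0 < log2 x.
Proof. by rewrite /log2 leq_max. Qed.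

Lemma adm_degree (v : vertex G) : degree v <= 2 ^ K.
Proof.
have [en dD nN _ _] := adm; apply: leq_trans (leq_exp_log2 _).
by rewrite leq_min dD (leq_trans (max_card _)) // en.
Qed.

Lemma adm_ident (v : vertex G) : ident v < 2 ^ (c * log2 N).
Proof.
have [_ _ nN _ id] := adm; apply: leq_trans (id v) _.
by rewrite leq_exp2l // leq_mul2l leq_log2 ?orbT.
Qed.

Lemma program_MIS : exists M : {set vertex G}, is_MIS M /\
  forall v, joined (exec s0 (program c N D) v) = (v \in M).
Proof.
rewrite /program -/K; set P1 := setup _ _; set P2 := loop _ _.
rewrite exec_cat [exec _ (P2 ++ _)]exec_cat {}/P1 {}/P2.
have [col [-> col_lt col_near]] := setup_ok level_bound_gt0 adm_degree adm_ident.
set s1 := finfun _.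
have inv1 : phase_inv K s1.
  split=> [v|v|v w vw|v w|v|v]; rewrite !ffunE //=; first exact: col_near.
  by split=> // w _; rewrite ffunE.
have [a ea] : exists a, a = 95 by exists 95.
rewrite -ea; have [inv] := phases_ok (a * (2 * log2 N).+1) ea adm_degree inv1.
set s2 := exec s1 _ => le.
(* At most [n ^ 2 <= 2 ^ (2 * log2 N)] pairs exist initially; after [2 * log2 N + 1] halvings an
   integral count below 1 is left. *)
have ap0 : active_pairs s2 = 0.
  have a0 : 0 < a by rewrite ea.
  apply/eqP; rewrite -leqn0 -ltnS.
  have le2 : 2 ^ (2 * log2 N).+1 * active_pairs s2 <= active_pairs s1.
    rewrite -(@leq_pmul2l (a ^ (a * (2 * log2 N).+1))) ?expn_gt0 ?a0 //.
    apply: leq_trans le; rewrite mulnA leq_mul2r mulnC expn_half ?orbT //.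
  have [en _ nN _ _] := adm.
  rewrite -(ltn_pmul2l (expn_gt0 2 (2 * log2 N).+1)) muln1.
  apply: leq_ltn_trans le2 _; apply: leq_ltn_trans (active_pairs_le _) _.
  apply: (@leq_ltn_trans (2 ^ (2 * log2 N))); last by rewrite ltn_exp2l.
  by rewrite en mulnC expnM leq_exp2r // (leq_trans nN) // leq_exp_log2.
exists [set v | joined (s2 v) || active (s2 v)]; split; last first.
  by move=> v; rewrite inE /= /step ffunE; case: (s2 v).
have no_active v w : active (s2 v) -> active (s2 w) -> ~~ adj v w.
  move=> av aw; apply/negP=> vw; move/eqP: ap0; rewrite sum_nat_eq0.
  move=> /forallP /(_ v) /=; rewrite av mul1n sum_nat_eq0 => /forallP /(_ w).
  by rewrite vw aw.
split=> [v w|v]; rewrite !inE.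
  case/orP=> hv /orP[] hw.
  - exact: inv_joined inv v w hv hw.
  - by apply: contraL hv => vw; have [_] := inv_active inv hw; apply; rewrite adj_sym.
  - by apply: contraL hw => vw; have [_] := inv_active inv hv; apply.
  exact: no_active.
rewrite negb_or => /andP[jv av]; case: (inv_retired inv av) => [jv'|[w vw jw]].
  by rewrite jv' in jv.
by exists w => //; rewrite inE jw.
Qed.

End Main.

Lemma computes_MIS_within_leq (A : algorithm) (G : network) N D T T' :
  T <= T' -> computes_MIS_within A G N D T -> computes_MIS_within A G N D T'.
Proof.
move=> TT' [M [mis H]]; exists M; split=> // v; have [t tT Ht] := H v.
by exists t; rewrite ?(leq_trans tT).
Qed.

Lemma rounding_MIS (c : nat) : exists (A : algorithm) (C B : nat),
  forall (n N D : nat) (G : network), admissible c n N D G ->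
    computes_MIS_within A G N D (C * (log2 D ^ 2 * log2 n)) /\
    messages_within A G N D (B * log2 n).
Proof.
have [C HC] := size_program c.
exists (machine (msg_width c) (program c) start), (2 * (C * c)), (9 * ((c + 64) * c)).
move=> n N D G adm; have [en dD nN lN id] := adm.
set K := level_bound N D; set w0 := color_bits c N D.
have K0 : 0 < K by apply: level_bound_gt0.
have l0 := log2_gt0 N.
have b0 : 2 * base_bits K <= w0 by rewrite /w0 /color_bits -/K; lia.
have sb0 : 4 * slot_bits K <= w0 by rewrite /w0 /color_bits -/K; lia.
have KN : K <= log2 N by apply: leq_log2; apply: geq_minr.
have KD : K <= log2 D by apply: leq_log2; apply: geq_minl.
split.
  have [M [mis HM]] := program_MIS adm.
  have comp : computes_MIS_within (machine (msg_width c) (program c) start) G N D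
                (size (program c N D)).*2.
    apply: (machine_computes (K := K) (Y := 2 ^ (4 * K + 2 + w0)) 
      (bounded := bounded K w0) _ _ _ _ _ mis HM).
    - exact: adm_degree adm.
    - by rewrite -expnD ltn_exp2l // /msg_width -/K -/w0; lia.
    - move=> r [h1 h2 h3 h4 h5 h6 h7]; rewrite -/(msg_width c N D).
      have fit x m : x <= 2 ^ m -> m < msg_width c N D -> x < 2 ^ msg_width c N D.
        by move=> xm mw; apply: leq_ltn_trans xm _; rewrite ltn_exp2l.
      have hw : msg_width c N D = 5 * K + 3 + w0 by [].
      have bit (b : bool) : b <= 2 ^ 0 by case: b.
      have h0 : lev r <= 2 ^ K by apply: leq_trans h1 _; apply/ltnW/ltn_expl.
      rewrite /= (fit _ _ (bit (active r))) ?(fit _ _ (bit (joined r))) ?(fit _ _ h0)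
        ?(fit _ _ h2) ?(fit _ _ h3) ?(fit _ _ (ltnW h4)) ?(fit _ _ (ltnW h5))
        ?(fit _ _ (ltnW h6)) ?(fit _ _ h7) //; lia.
    - move=> v; split=> //=; rewrite ?expn_gt0 //.
      apply: leq_trans (adm_ident adm v) _.
      by rewrite leq_exp2l // /w0 /color_bits; lia.
    rewrite /program -/K; apply: every_cat; first exact: setup_tame.
    apply: every_cat; first by apply: every_loop => i _; exact: phase_tame.
    by split=> //; exact: final_tame.
  apply: computes_MIS_within_leq comp.
  rewrite -mul2n -!mulnA leq_mul2l /=; apply: leq_trans (HC N D) _; rewrite -/K.
  rewrite leq_mul2l; apply/orP; right.
  apply: (@leq_trans (log2 D ^ 2 * (c * log2 n))); last by lia.
  by apply: leq_mul => //; rewrite leq_exp2r.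
have msg := @machine_messages (msg_width c) (program c) start G N D.
move=> t v p lp; apply: leq_trans (msg t v p lp) _.
rewrite -mulnA leq_mul2l /= /msg_width -/K -/w0.
apply: (@leq_trans ((c + 64) * log2 N)); last by rewrite -mulnA leq_mul2l lN orbT.
rewrite /w0 /color_bits -/K /base_bits; have := slot_bits_le K; lia.
Qed.

Theorem theorem3p1 :
  (* LOCAL *)
  (forall c : nat, exists (A : algorithm) (C : nat),
     forall (n N Delta : nat) (G : network), admissible c n N Delta G ->
       computes_MIS_within A G N Delta (C * (log2 Delta ^ 2 * log2 n)))
  /\
  (* CONGEST *)
  (forall c : nat, exists (A : algorithm) (C B : nat),
     forall (n N Delta : nat) (G : network), admissible c n N Delta G ->
       computes_MIS_within A G N Delta
         (C * (log2 Delta ^ 2 * log2 (log2 Delta) * log2 n)) /\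
       messages_within A G N Delta (B * log2 n)).
Proof.
split=> c; have [A [C [B H]]] := rounding_MIS c.
  by exists A, C => n N Delta G /H [].
exists A, C, B => n N Delta G /H [comp msg]; split=> //.
apply: computes_MIS_within_leq comp; rewrite leq_mul2l; apply/orP; right.
by rewrite leq_mul2r leq_pmulr ?orbT // log2_gt0.
Qed.
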